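(* Let $m\ge0$ and $\lambda,\mu$ partitions of $m$. There exists a unique $n_0\in N(m)$ such that $\langle\mathrm{ss}_{\lambda,n},\mathrm{ss}_{\mu,n}\rangle=0$ for all $n\in N(m)$ with $n<n_0$, and $\langle\mathrm{ss}_{\lambda,n},\mathrm{ss}_{\mu,n}\rangle>0$ for all $n\in N(m)$ with $n\ge n_0$.
   Context: $N(m)=\{n\ge m: n\equiv m\pmod 2\}$. $\langle\cdot,\cdot\rangle$ is the Hall inner product on homogeneous symmetric functions of degree $n$ (infinitely many variables), for which the Schur functions of degree $n$ are orthonormal. A skew shape is a horizontal strip if it has at most one box in each column. An SSOT of shape $\lambda$ is a sequence of partitions $S=(S^1,S'^2,S^2,S'^3,\dots)$ such that, with $S^0=S'^1=\emptyset$: for all $i\ge1$, $S'^i\subseteq S^{i-1}$, $S'^i\subseteq S^i$, and $S^{i-1}/S'^i$, $S^i/S'^i$ are horizontal strips (possibly empty); and $S^i=S'^{i+1}=\lambda$ for all large $i$. Put $m_i(S)=|S^{i-1}/S'^i|+|S^i/S'^i|$, length $n=\sum_i m_i(S)$, $x^S=\prod_ix_i^{m_i(S)}$. $\mathrm{ss}_{\lambda,n}(x)=\sum x^S$ over SSOTs of shape $\lambda$ and length $n$; it is a homogeneous symmetric function of degree $n$. *)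

(* Defs.v *)
From HB Require Import structures.
From mathcomp Require Import all_boot all_order all_algebra finmap.
From mathcomp Require Import boolp classical_sets functions cardinality fsbigop.

Set Implicit Arguments.
Unset Strict Implicit.
Unset Printing Implicit Defensive.

Import Order.TTheory GRing.Theory Num.Theory.
Local Open Scope classical_set_scope.
Local Open Scope ring_scope.

(** * Integer partitions *)

Record part := Part {
  pseq :> seq nat;
  partP : sorted geq pseq && (0%N \notin pseq)
}.
HB.instance Definition _ := [isSub for pseq].
HB.instance Definition _ := [Choice of part by <:].

Definition empty_part : part := @Part [::] isT.

Definition psize (la : part) : nat := sumn la.

Definition parts (n : nat) : set part := [set la | psize la = n].

(* Box in row [i] and column [j] of the Young diagram; both are counted from
   [0]. *)
Definition in_diagram (la : part) (i j : nat) : Prop := (j < nth 0 la i)%N.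

Definition psub (mu la : part) : Prop :=
  forall i j, in_diagram mu i j -> in_diagram la i j.

Definition in_skew (la mu : part) (i j : nat) : Prop :=
  in_diagram la i j /\ ~ in_diagram mu i j.

(* Truncated subtraction; only used when [psub mu la]. *)
Definition skew_size (la mu : part) : nat := (psize la - psize mu)%N.

(* The skew shape [la / mu] is defined and has at most one box per column. *)
Definition horizontal_strip (la mu : part) : Prop :=
  psub mu la /\
  forall i1 i2 j, in_skew la mu i1 j -> in_skew la mu i2 j -> i1 = i2.

(** * Formal power series in infinitely many variables *)

(* A monomial is given by its finitely supported exponent. The variables
   [x_1, x_2, ...] are indexed from [0]: index [k] stands for [x_(k+1)]. *)
Definition monom := {fsfun nat -> nat with 0%N}.

(* A formal power series, given by its coefficients. *)
Definition series := monom -> rat.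

(** * Schur functions and the Hall inner product *)

(* Semistandard tableaux, given by the list of their rows. *)
Definition is_ssyt (la : part) (T : seq (seq nat)) : Prop :=
  [/\ map size T = la,
      all (sorted leq) T &
      forall i j, in_diagram la i.+1 j ->
        (nth 0 (nth [::] T i) j < nth 0 (nth [::] T i.+1) j)%N].

(* The coefficient of [x^a] is the number of semistandard tableaux of shape
   [la] in which each [k] occurs [a k] times; there are finitely many of
   them, so that [fset_set] does not return its default value. *)
Definition schur (la : part) : series := fun a =>
  (#|` fset_set [set T | is_ssyt la T /\
                         forall k, count_mem k (flatten T) = a k] |)%:R.

(* The coordinates of [f] in the basis of Schur functions of degree [n], for
   [f] a homogeneous symmetric function of degree [n]; only the values of the
   result on [parts n] are meaningful. *)
Definition schur_coord (n : nat) (f : series) : part -> rat :=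
  xget (fun=> 0)
    [set c | forall a, f a = \sum_(la \in parts n) c la * schur la a].

(* The inner product on homogeneous symmetric functions of degree [n] for
   which the Schur functions are orthonormal. *)
Definition hall (n : nat) (f g : series) : rat :=
  \sum_(la \in parts n) schur_coord n f la * schur_coord n g la.

(** * Semistandard oscillating tableaux *)

(* A sequence [(S^1, S'^2, S^2, S'^3, ...)], with [S^0] and [S'^1] added at
   the front. The first component maps [i] to [S^i], and the second one maps
   [i] to [S'^(i+1)]. *)
Definition osc := ((nat -> part) * (nat -> part))%type.

Definition is_ssot (la : part) (S : osc) : Prop :=
  [/\ S.1 0%N = empty_part /\ S.2 0%N = empty_part,
      forall i, horizontal_strip (S.1 i) (S.2 i),
      forall i, horizontal_strip (S.1 i.+1) (S.2 i) &
      exists i0, forall i, (i0 <= i)%N -> S.1 i = la /\ S.2 i = la].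

(* [osc_mult S i] is [m_(i+1)(S)], the exponent of [x_(i+1)] in [x^S]. *)
Definition osc_mult (S : osc) (i : nat) : nat :=
  (skew_size (S.1 i) (S.2 i) + skew_size (S.1 i.+1) (S.2 i))%N.

Definition osc_length (S : osc) : nat :=
  \big[addn/0%N]_(i \in [set: nat]) osc_mult S i.

(* The coefficient of [x^a] in the sum of the [x^S] is the number of [S] with
   [x^S = x^a], which is finite. *)
Definition ss (la : part) (n : nat) : series := fun a =>
  (#|` fset_set [set S : osc | [/\ is_ssot la S, osc_length S = n &
                                   forall i, osc_mult S i = a i]] |)%:R.

Definition Nset (m : nat) : set nat :=
  [set n | (m <= n)%N /\ n = m %[mod 2]].

(* Main.v *)
(* By induction on the number of variables, with the Pieri rule, [ss la] is the
   Schur function of [la] times the sum of the Schur functions of the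
   partitions [be] with all columns of even length. By the
   Littlewood-Richardson rule, proved with Stembridge's sign-reversing
   involution in [N] variables, the Schur coordinate of [ss la]
   on [nu] counts the pairs of such a [be] and a tableau of shape [la] and
   weight [nu - be] all of whose final column segments keep [be] dominant.
   Hence the inner product is positive exactly when some [nu] is reached from
   both [la] and [mu]. Adding the partition (1, 1) to [be] and to [nu] passes
   from degree [n] to degree [n + 2], and for
   [be = (m - 1, m - 1, m - 2, m - 2, ..., 0, 0)] the partition
   [nu = be + (1, 0, 1, 0, ...)] is reached from every partition of [m]. *)
Require Import Defs.
From HB Require Import structures.
From mathcomp Require Import all_boot all_order all_algebra finmap.
From mathcomp Require Import all_fingroup.
From mathcomp Require Import mpoly zify.
From mathcomp Require Import boolp classical_sets functions cardinality fsbigop.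

Set Implicit Arguments.
Unset Strict Implicit.
Unset Printing Implicit Defensive.

Import Order.TTheory GRing.Theory Num.Theory.
Local Open Scope classical_set_scope.
Local Open Scope ring_scope.

Lemma fsum_bij (T U : choiceType) (R : nmodType) (A : set T) (B : set U)
    (h : T -> U) (h' : U -> T) (F : U -> R) (G : T -> R) :
  (forall x, A x -> B (h x)) -> (forall y, B y -> A (h' y)) ->
  (forall x, A x -> h' (h x) = x) -> (forall y, B y -> h (h' y) = y) ->
  (forall x, A x -> F (h x) = G x) ->
  \sum_(y \in B) F y = \sum_(x \in A) G x.
Proof.
move=> AB BA hK h'K FG; rewrite (@reindex_fsbig _ _ _ _ _ h A B).
  by apply: eq_fsbigr => x; rewrite inE => /FG.
split.
- by move=> x /AB.
- by move=> x y; rewrite !inE => /hK xK /hK yK e; rewrite -xK e yK.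
- by move=> y By; exists (h' y); [exact: BA | exact: h'K].
Qed.

Lemma fsum_fibers (T U : choiceType) (R : nmodType) (A : set T) (B : set U)
    (p : T -> U) (F : T -> R) :
  finite_set A -> finite_set B -> (forall x, A x -> B (p x)) ->
  \sum_(x \in A) F x =
  \sum_(u \in B) \sum_(x \in [set x | A x /\ p x = u]) F x.
Proof.
move=> fA fB AB.
transitivity (\sum_(x \in A) \sum_(u \in B) (if p x == u then F x else 0)).
  apply: eq_fsbigr => x; rewrite inE => Ax.
  rewrite (fsbigD1 (p x)) ?eqxx //=; last exact: AB.
  rewrite fsbig1 ?addr0 // => u [_ /= ne].
  by rewrite ifN // eq_sym; apply/eqP.
rewrite exchange_fsbig //; apply: eq_fsbigr => u _.
have -> : [set x | A x /\ p x = u] = A `&` [set x | p x = u] by [].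
rewrite fsbig_mkcondr; apply: eq_fsbigr => x _; congr (if _ then _ else _).
by apply/eqP/idP; rewrite inE.
Qed.

Lemma finite_fun (T : Type) (A : set T) (t : T) (n : nat) :
  finite_set A ->
  finite_set [set g : nat -> T |
    (forall i, A (g i)) /\ forall i, (n <= i)%N -> g i = t].
Proof.
move=> fA; elim: n => [|n IHn].
  apply: (@sub_finite_set _ _ [set (fun=> t)]); last exact: finite_set1.
  by move=> g [_ gt] /=; apply/funext => i; apply: gt.
pose cons (p : T * (nat -> T)) i := if i is i'.+1 then p.2 i' else p.1.
apply: sub_finite_set (finite_image cons (finite_setX fA IHn)) => g [Ag gt] /=.
exists (g 0%N, fun i => g i.+1); last by apply/funext => -[].
by split=> /=; [exact: Ag | split=> // i ni; exact: gt].
Qed.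

Lemma card_fset_set_bij (T U : choiceType) (A : set T) (B : set U)
    (h : T -> U) (h' : U -> T) :
  finite_set A ->
  (forall x, A x -> B (h x)) -> (forall y, B y -> A (h' y)) ->
  (forall x, A x -> h' (h x) = x) -> (forall y, B y -> h (h' y) = y) ->
  #|` fset_set A| = #|` fset_set B|.
Proof.
move=> fA AB BA hK h'K.
have -> : B = h @` A.
  apply/seteqP; split=> [y By|_ [x Ax <-]]; last exact: AB.
  by exists (h' y); [exact: BA | exact: h'K].
rewrite fset_set_image // card_in_imfset //= => x y.
by rewrite !in_fset_set // !inE => /hK xK /hK yK e; rewrite -xK e yK.
Qed.

Lemma card_fset_setE (T : choiceType) (R : pzSemiRingType) (A : set T) :
  finite_set A -> #|` fset_set A|%:R = \sum_(x \in A) (1 : R) :> R.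
Proof.
by move=> fA; rewrite fsbig_finite //= big_const_seq count_predT iter_addr_0.
Qed.

(** * Partitions *)

Definition row (la : part) (k : nat) : nat := nth 0%N la k.

Lemma row_noninc (la : part) k l : (k <= l)%N -> (row la l <= row la k)%N.
Proof.
have /andP[s_la _] := partP la.
case: (ltnP l (size la)) => [l_lt k_le|l_ge _]; last by rewrite /row nth_default.
have tr : transitive geq by move=> a b c ab bc; apply: leq_trans bc ab.
have : geq (row la k) (row la l); last by [].
by apply: (sorted_leq_nth tr leqnn 0%N s_la) => //; apply: leq_ltn_trans l_lt.
Qed.

Lemma row_gt0 (la : part) k : (0 < row la k)%N = (k < size la)%N.
Proof.
have /andP[_ n0] := partP la.
case: (ltnP k (size la)) => [kl|lk]; last by rewrite /row nth_default.
by rewrite lt0n; apply: contra n0 => /eqP <-; apply: mem_nth.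
Qed.

Lemma row0 k : row empty_part k = 0%N.
Proof. by rewrite /row nth_nil. Qed.

Lemma part_ext (la mu : part) : (forall k, row la k = row mu k) -> la = mu.
Proof.
move=> e; have es : size la = size mu.
  apply/eqP; rewrite eqn_leq; apply/andP; split.
    by rewrite leqNgt -row_gt0 e row_gt0 ltnn.
  by rewrite leqNgt -row_gt0 -e row_gt0 ltnn.
by apply/val_inj; apply: (eq_from_nth es) => k _; apply: e.
Qed.

Definition ofrow (f : nat -> nat) : part :=
  xget empty_part [set la | forall k, row la k = f k].

Lemma row_ofrow (f : nat -> nat) n :
  (forall k, (f k.+1 <= f k)%N) -> (forall k, (n <= k)%N -> f k = 0%N) ->
  forall k, row (ofrow f) k = f k.
Proof.
move=> f_dec f0; have {}f_dec : {homo f : i j / (i <= j)%N >-> (j <= i)%N}.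
  apply: homo_leq => //= a b c ab bc; exact: leq_trans bc ab.
suff: exists la : part, forall k, row la k = f k.
  by case=> la Pla; apply: (@xgetI _ empty_part [set la | forall k, row la k = f k] la).
have [l [fl lf]] : exists l, (forall k, (l <= k)%N -> f k = 0%N) /\
                             (forall k, (k < l)%N -> (0 < f k)%N).
  have /ex_minnP[l /eqP fl lmin] : exists l, f l == 0%N.
    by exists n; rewrite f0.
  exists l; split=> k kl; first by apply/eqP; rewrite -leqn0 -fl f_dec.
  by rewrite lt0n; apply: contraTneq kl => /eqP /lmin; rewrite -leqNgt.
have P : sorted geq (mkseq f l) && (0%N \notin mkseq f l).
  apply/andP; split.
    rewrite sorted_map; apply: sub_sorted (iota_sorted 0 l) => i j /=.
    exact: f_dec.
  by apply/mapP => -[k]; rewrite mem_iota => /= /lf; case: (f k).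
exists (Part P) => k; rewrite /row /=; case: (ltnP k l) => kl.
  by rewrite nth_mkseq.
by rewrite nth_default ?size_mkseq // fl.
Qed.

Definition ovr (c : nat) (la : part) : nat := sumn [seq (x - c)%N | x <- la].

Lemma ovr0 la : ovr 0 la = psize la.
Proof.
rewrite /ovr /psize; congr sumn.
by rewrite -[RHS]map_id; apply: eq_map => x; rewrite subn0.
Qed.

Lemma row_eq0 (la : part) n k :
  (row la n = 0 -> n <= k -> row la k = 0)%N.
Proof. by move=> e nk; apply/eqP; rewrite -leqn0 -e row_noninc. Qed.

Lemma ovrE c (la : part) n : row la n = 0%N ->
  ovr c la = (\sum_(k < n) (row la k - c))%N.
Proof.
move=> e; have sn : (size la <= n)%N by rewrite leqNgt -row_gt0 e.
rewrite /ovr sumnE big_map (big_nth 0%N) big_mkord.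
rewrite (big_ord_widen n (fun k => row la k - c)%N sn) big_mkcond /=.
apply: eq_bigr => k _; case: ltnP => // /(nth_default 0%N).
by rewrite /row => ->.
Qed.

Lemma psizeE (la : part) n : row la n = 0%N ->
  psize la = (\sum_(k < n) row la k)%N.
Proof.
by move=> e; rewrite -ovr0 (ovrE 0 e); apply: eq_bigr => k _; rewrite subn0.
Qed.

Lemma row_size (la : part) : row la (size la) = 0%N.
Proof. by rewrite /row nth_default. Qed.

Lemma psize_empty : psize empty_part = 0%N. Proof. by []. Qed.

Lemma leq_row_psize (la : part) k : (row la k <= psize la)%N.
Proof.
case: (ltnP k (size la)) => [kl|lk]; last by rewrite /row nth_default.
by rewrite (psizeE (row_size la)) (bigD1 (Ordinal kl)) //= leq_addr.
Qed.

Lemma leq_size_psize (la : part) : (size la <= psize la)%N.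
Proof.
rewrite (psizeE (row_size la)) -{1}(card_ord (size la)) -sum1_card.
by apply: leq_sum => k _; rewrite row_gt0.
Qed.

Lemma row_psize (la : part) n : (psize la <= n)%N -> row la n = 0%N.
Proof.
by move=> e; apply: (row_eq0 (row_size la)); apply: leq_trans e; apply: leq_size_psize.
Qed.

Lemma psize_eq0 (la : part) : psize la = 0%N -> la = empty_part.
Proof.
move=> e; apply: part_ext => k; rewrite row0.
by apply/eqP; rewrite -leqn0 -e leq_row_psize.
Qed.

Lemma finite_parts_le n : finite_set [set la | (psize la <= n)%N].
Proof.
have fA : finite_set [set k | (k < n.+1)%N] by apply: finite_II.
have := finite_image ofrow (finite_fun 0%N n fA).
apply: sub_finite_set => la /= la_n; exists (row la).
  split=> [i|i ni]; first exact: leq_trans (leq_row_psize _ _) _.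
  by apply: row_psize; apply: leq_trans ni.
apply: part_ext => k; apply: (@row_ofrow _ n) => [l|l nl].
  exact: row_noninc.
by apply: row_psize; apply: leq_trans nl.
Qed.

Lemma finite_parts n : finite_set (parts n).
Proof.
by apply: sub_finite_set (finite_parts_le n) => la /= ->.
Qed.

Definition hs (la mu : part) : Prop :=
  forall k, (row mu k <= row la k)%N /\ (row la k.+1 <= row mu k)%N.

Lemma hstripP la mu : horizontal_strip la mu <-> hs la mu.
Proof.
split=> [[sub one] k|h].
  have sub' l : (row mu l <= row la l)%N.
    case: (ltnP 0 (row mu l)) => [mu0|]; last by rewrite leqn0 => /eqP ->.
    have := sub l (row mu l).-1; rewrite /in_diagram -!/(row _ _).
    by rewrite prednK // leqnn => /(_ isT).
  split=> //; rewrite leqNgt; apply/negP => lt.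
  have k1 : in_skew la mu k.+1 (row mu k).
    split; first exact: lt.
    by rewrite /in_diagram -/(row _ _); apply/negP; rewrite -leqNgt row_noninc.
  have k0 : in_skew la mu k (row mu k).
    split; last by rewrite /in_diagram -/(row _ _) ltnn.
    by rewrite /in_diagram -/(row _ _); apply: leq_trans lt _; apply: row_noninc.
  by have := one _ _ _ k0 k1; lia.
have nolt i1 i2 j : in_skew la mu i1 j -> in_skew la mu i2 j -> ~ (i1 < i2)%N.
  move=> [_ /negP n1] [l2 _] lt; move: n1 l2.
  rewrite /in_diagram -!/(row _ _) -leqNgt => n1 l2.
  have [_ h2] := h i1.
  have := row_noninc la lt; lia.
split=> [i j|i1 i2 j s1 s2].
  by rewrite /in_diagram -!/(row _ _) => lt; apply: leq_trans lt _; case: (h i).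
by case: (ltngtP i1 i2) => // lt; [case: (nolt i1 i2 j)|case: (nolt i2 i1 j)].
Qed.

Lemma hs_row0 la mu n : hs la mu -> row la n = 0%N -> row mu n = 0%N.
Proof. by move=> h e; apply/eqP; rewrite -leqn0 -e; case: (h n). Qed.

Lemma hs_ovr c la mu : hs la mu -> (ovr c mu <= ovr c la)%N.
Proof.
move=> h; have e := row_size la; have e' := hs_row0 h e.
rewrite (ovrE c e) (ovrE c e'); apply: leq_sum => k _.
by apply: leq_sub2r; case: (h k).
Qed.

Lemma hs_psize la mu : hs la mu -> (psize mu <= psize la)%N.
Proof. by rewrite -!ovr0; apply: hs_ovr. Qed.

Lemma hs_psize_eq la mu : hs la mu -> psize la = psize mu -> la = mu.
Proof.
move=> h e; have l0 := row_size la; have m0 := hs_row0 h l0.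
apply: part_ext => k; apply/eqP; rewrite eqn_leq; case: (h k) => -> _.
rewrite andbT leqNgt; apply/negP => lt.
have kn : (k < size la)%N by rewrite -row_gt0; apply: leq_trans lt.
move: e; rewrite (psizeE l0) (psizeE m0) => e.
have : (\sum_(i < size la) row mu i < \sum_(i < size la) row la i)%N.
  rewrite (bigD1 (Ordinal kn)) //= [X in (_ < X)%N](bigD1 (Ordinal kn)) //=.
  by rewrite -addSn leq_add // leq_sum // => i _; case: (h i).
by rewrite e ltnn.
Qed.

Lemma hs_refl la : hs la la.
Proof. by move=> k; split=> //; apply: row_noninc. Qed.

(* [cnt c la] is the length of column [c]. *)
Definition cnt (c : nat) (la : part) : nat := count (fun x => c < x)%N la.

Lemma ltn_cnt c (la : part) k : (k < cnt c la)%N = (c < row la k)%N.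
Proof.
have /andP[s_la _] := partP la.
rewrite /cnt /row; elim: (pseq la) s_la k => [|x s IHs] /= ps k.
  by rewrite nth_nil.
have ss := path_sorted ps.
have tr : transitive geq by move=> a b d ab bd; apply: leq_trans bd ab.
case: (ltnP c x) => cx /=.
  by case: k => [|k] /=; rewrite ?cx // add1n ltnS IHs.
have -> : count (fun x => c < x)%N s = 0%N.
  apply/eqP; rewrite -leqn0 leqNgt -has_count; apply/hasPn => y ys.
  rewrite -leqNgt; apply: leq_trans cx.
  by have /allP/(_ y ys) := order_path_min tr ps.
rewrite ltn0; case: k => [|k] /=; first by apply/esym/negbTE; rewrite -leqNgt.
apply/esym/negbTE; rewrite -leqNgt; apply: leq_trans cx.
case: (ltnP k (size s)) => ks; last by rewrite nth_default.
by have /allP/(_ _ (mem_nth 0%N ks)) := order_path_min tr ps.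
Qed.

Lemma ovrS c la : ovr c la = (ovr c.+1 la + cnt c la)%N.
Proof.
rewrite /ovr /cnt; elim: (pseq la) => //= x s ->.
by case: (ltnP c x) => cx /=; lia.
Qed.

Lemma cnt_hs c la mu : hs la mu -> (cnt c mu <= cnt c la <= (cnt c mu).+1)%N.
Proof.
move=> h; apply/andP; split; rewrite leqNgt; apply/negP => lt.
  move: (lt); rewrite ltn_cnt; apply/negP; rewrite -leqNgt.
  have : (row la (cnt c la) <= c)%N by rewrite leqNgt -ltn_cnt ltnn.
  by apply: leq_trans; case: (h (cnt c la)).
move: (lt); rewrite ltn_cnt; apply/negP; rewrite -leqNgt.
have : (row mu (cnt c mu) <= c)%N by rewrite leqNgt -ltn_cnt ltnn.
by apply: leq_trans; case: (h (cnt c mu)).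
Qed.

(** * Bender-Knuth involutions *)

Definition gt (N : nat) (la : part) : set (nat -> part) :=
  [set g | [/\ g 0%N = empty_part, forall i, hs (g i.+1) (g i) &
               forall i, (N <= i)%N -> g i = la]].

Definition wt (g : nat -> part) (i : nat) : nat :=
  (psize (g i.+1) - psize (g i))%N.

Definition togup (c : nat) (lo hi : part) (k : nat) : nat :=
  minn (minn c (row hi k)) (if k is l.+1 then row lo l else c).

Definition toglow (lo hi : part) (k : nat) : nat :=
  maxn (row hi k.+1) (row lo k).

(* The entries equal to the middle letter or the next one, in the first [c]
   columns, are exchanged by reflecting each row of [mid] in the interval that
   the interlacing with [lo] and [hi] leaves to it. *)
Definition togrow (c : nat) (lo mid hi : part) (k : nat) : nat :=
  if (c < row mid k)%N then row mid k
  else (togup c lo hi k + toglow lo hi k - row mid k)%N.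

Definition tog (c : nat) (lo mid hi : part) : part := ofrow (togrow c lo mid hi).

Section Toggle.
Variables (c : nat) (lo mid hi : part).
Hypotheses (ml : hs mid lo) (hm : hs hi mid).
Hypothesis cP : forall k, (c < row mid k)%N -> (c < row lo k)%N.

Lemma toglow_bounds k :
  [/\ (toglow lo hi k <= row mid k)%N, (row hi k.+1 <= toglow lo hi k)%N &
      (row lo k <= toglow lo hi k)%N].
Proof. by have [? ?] := ml k; have [? ?] := hm k; rewrite /toglow; split; lia. Qed.

Lemma togup_bounds k : (row mid k <= c)%N ->
  [/\ (row mid k <= togup c lo hi k)%N, (togup c lo hi k <= row hi k)%N &
      (togup c lo hi k <= c)%N].
Proof.
have [] := hm k; rewrite /togup; case: k => [|k] ? ? ?; last have [? ?] := ml k.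
  by split; lia.
by split; lia.
Qed.

Lemma togup_le k : (togup c lo hi k.+1 <= row lo k)%N.
Proof. by rewrite /togup geq_minr. Qed.

Lemma togrow_bounds k :
  [/\ (row lo k <= togrow c lo mid hi k)%N, (togrow c lo mid hi k <= row hi k)%N,
      (row hi k.+1 <= togrow c lo mid hi k)%N &
      (togrow c lo mid hi k.+1 <= row lo k)%N].
Proof.
have [l1 l2 l3] := toglow_bounds k; have [l4 l5 l6] := toglow_bounds k.+1.
have [m1 m2] := ml k; have [h1 h2] := hm k.
have up := togup_le k.
rewrite /togrow; case: (ltnP c (row mid k)) => [_|/togup_bounds[u1 u2 u3]];
  case: (ltnP c (row mid k.+1)) => [_|/togup_bounds[u4 u5 u6]]; split; lia.
Qed.

Lemma row_tog k : row (tog c lo mid hi) k = togrow c lo mid hi k.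
Proof.
apply: (@row_ofrow _ (size hi)) => {}k.
  by have [l _ _ h] := togrow_bounds k; apply: leq_trans h l.
move=> kh; apply/eqP; rewrite -leqn0 -(row_eq0 (row_size hi) kh).
by have [_ h _ _] := togrow_bounds k.
Qed.

Lemma hs_tog_lo : hs (tog c lo mid hi) lo.
Proof. by move=> k; rewrite !row_tog; have [] := togrow_bounds k. Qed.

Lemma hs_hi_tog : hs hi (tog c lo mid hi).
Proof. by move=> k; rewrite !row_tog; have [] := togrow_bounds k. Qed.

Lemma tog_above k : (row (tog c lo mid hi) k - c = row mid k - c)%N.
Proof.
rewrite row_tog /togrow; case: (ltnP c (row mid k)) => // mc.
by have [? ? ?] := togup_bounds mc; have [? ? ?] := toglow_bounds k; lia.
Qed.

Lemma ovr_tog c' : (c <= c')%N -> ovr c' (tog c lo mid hi) = ovr c' mid.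
Proof.
move=> cc; have e := hs_row0 hm (row_size hi).
have e' := hs_row0 hs_hi_tog (row_size hi).
rewrite (ovrE c' e) (ovrE c' e'); apply: eq_bigr => k _.
have := tog_above k; lia.
Qed.

Lemma psize_tog :
  (psize (tog c lo mid hi) + psize mid + ovr c lo + ovr c hi =
   psize lo + psize hi + 2 * ovr c mid)%N.
Proof.
have hi0 := row_size hi; have hi0S := row_eq0 hi0 (leqnSn _).
have e := hs_row0 hm hi0; have el := hs_row0 ml e.
have e' := hs_row0 hs_hi_tog hi0.
pose n := size hi; rewrite -/n in hi0 hi0S e el e' *.
rewrite (psizeE e') (psizeE e) (psizeE el) (psizeE hi0).
rewrite (ovrE c e) (ovrE c el) (ovrE c hi0).
have H l : (\sum_(k < l.+1) row (tog c lo mid hi) k + \sum_(k < l.+1) row mid k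
            + \sum_(k < l.+1) (row lo k - c) + \sum_(k < l.+1) (row hi k - c)
            + minn (minn c (row hi l.+1)) (row lo l) =
  \sum_(k < l.+1) row lo k + \sum_(k < l.+1) row hi k
   + 2 * (\sum_(k < l.+1) (row mid k - c)) + minn c (row hi l.+1))%N.
  elim: l => [|l].
    rewrite !big_ord1 row_tog /togrow /togup /toglow /=.
    have [? ?] := ml 0%N; have [? ?] := hm 0%N; have := @cP 0%N.
    by case: (ltnP c (row mid 0%N)) => mc; lia.
  rewrite !(big_ord_recr l.+1) /= row_tog.
  have : (togrow c lo mid hi l.+1 + row mid l.+1 + (row lo l.+1 - c)
    + (row hi l.+1 - c) + minn (minn c (row hi l.+2)) (row lo l.+1) + minn c (row hi l.+1)
    = minn (minn c (row hi l.+1)) (row lo l)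
      + row lo l.+1 + row hi l.+1 + 2 * (row mid l.+1 - c) + minn c (row hi l.+2))%N.
    rewrite /togrow /togup /toglow; have [? ?] := ml l; have [? ?] := hm l.
    have [? ?] := ml l.+1; have [? ?] := hm l.+1; have := @cP l.+1.
    by case: (ltnP c (row mid l.+1)) => mc; lia.
  lia.
case: n hi0 hi0S e el e' H => [|n] hi0 hi0S e el e' H.
  by rewrite !big_ord0.
by have := H n; rewrite hi0; lia.
Qed.

End Toggle.

Lemma togK c lo mid hi : hs mid lo -> hs hi mid ->
  tog c lo (tog c lo mid hi) hi = mid.
Proof.
move=> ml hm; have h1 := hs_tog_lo c ml hm; have h2 := hs_hi_tog c ml hm.
apply: part_ext => k; rewrite row_tog //.
have := tog_above c ml hm k; rewrite /togrow row_tog // /togrow.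
have [? ? ?] := toglow_bounds ml hm k.
case: (ltnP c (row mid k)) => [mc|mc]; first by rewrite mc.
by have [? ? ?] := togup_bounds ml hm mc; case: ltnP => ?; lia.
Qed.

Definition togg (c i : nat) (g : nat -> part) : nat -> part :=
  fun j => if j == i.+1 then tog c (g i) (g i.+1) (g i.+2) else g j.

Lemma togg_lo c i g : togg c i g i = g i.
Proof. by rewrite /togg ifN //; apply/eqP; lia. Qed.

Lemma togg_mid c i g : togg c i g i.+1 = tog c (g i) (g i.+1) (g i.+2).
Proof. by rewrite /togg eqxx. Qed.

Lemma togg_hi c i g : togg c i g i.+2 = g i.+2.
Proof. by rewrite /togg ifN //; apply/eqP; lia. Qed.

Lemma wt_togg_out c i g j : j != i -> j != i.+1 -> wt (togg c i g) j = wt g j.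
Proof. by move=> ji ji'; rewrite /wt /togg !ifN // eqSS. Qed.

Section ToggleChain.
Variables (N : nat) (la : part) (c i : nat) (g : nat -> part).
Hypotheses (iN : (i.+1 < N)%N) (gP : gt N la g).
Hypothesis cP : forall k, (c < row (g i.+1) k)%N -> (c < row (g i) k)%N.

Lemma gt_togg : gt N la (togg c i g).
Proof.
have [g0 gh gl] := gP; split=> [|j|j jN]; rewrite /togg.
- by [].
- have [ji|ji] := eqVneq j.+1 i.+1; have [ji'|ji'] := eqVneq j i.+1; try lia.
  + rewrite (_ : j = i); [exact: hs_tog_lo | lia].
  + by rewrite ji'; apply: hs_hi_tog.
  + exact: gh.
by rewrite ifN ?gl //; apply/eqP; lia.
Qed.

Lemma toggK : togg c i (togg c i g) = g.
Proof.
have [g0 gh gl] := gP; apply/funext => j.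
rewrite {1}/togg togg_lo togg_mid togg_hi; have [->|ji] := eqVneq j i.+1.
  exact: togK.
by rewrite /togg ifN.
Qed.

Lemma ovr_togg c' j : (c <= c')%N -> ovr c' (togg c i g j) = ovr c' (g j).
Proof.
have [g0 gh gl] := gP.
by move=> cc; rewrite /togg; have [->|//] := eqVneq j i.+1; apply: ovr_tog.
Qed.

Lemma psize_togg :
  (psize (togg c i g i.+1) + psize (g i.+1) + ovr c (g i) + ovr c (g i.+2) =
   psize (g i) + psize (g i.+2) + 2 * ovr c (g i.+1))%N.
Proof. by have [g0 gh gl] := gP; rewrite togg_mid; apply: psize_tog. Qed.

End ToggleChain.

Section Polynomials.
Variable N : nat.
Implicit Types (p q : {mpoly rat[N]}) (w : nat -> nat).

Definition mon w : 'X_{1..N} := [multinom w (val i) | i < N].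

Definition xw w : {mpoly rat[N]} := 'X_[mon w].

Lemma xwD w1 w2 : xw (fun i => w1 i + w2 i)%N = xw w1 * xw w2.
Proof.
by rewrite /xw -mpolyXD; congr 'X_[_]; apply/mnmP => i; rewrite mnmDE !mnmE.
Qed.

Lemma eq_xw w1 w2 : (forall i, (i < N)%N -> w1 i = w2 i) -> xw w1 = xw w2.
Proof.
by move=> e; rewrite /xw; congr 'X_[_]; apply/mnmP => i; rewrite !mnmE e ?ltn_ord.
Qed.

Lemma msym_xw (i j : 'I_N) w :
  msym (tperm i j) (xw w) =
  xw (fun k => if k == i then w j else if k == j then w i else w k).
Proof.
rewrite /xw msymX tpermV; congr 'X_[_]; apply/mnmP => k; rewrite !mnmE.
case: tpermP => [->|->|/eqP ki /eqP kj]; first by rewrite eqxx.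
  by rewrite eqxx; case: eqP => [->|].
by rewrite !val_eqE (negbTE ki) (negbTE kj).
Qed.

Lemma issym_adjacent p :
  (forall i j : 'I_N, j = i.+1 :> nat -> msym (tperm i j) p = p) ->
  p \is symmetric.
Proof.
move=> adj.
have mulP s t : msym s p = p -> msym t p = p -> msym (s * t)%g p = p.
  by move=> sp tp; rewrite msymMm sp.
have tp d (i j : 'I_N) : (j = i + d.+1 :> nat)%N -> msym (tperm i j) p = p.
  elim: d j => [|d IHd] j e; first by apply: adj; rewrite e addn1.
  have kN : (i + d.+1 < N)%N by apply: leq_ltn_trans (ltn_ord j); lia.
  pose k := Ordinal kN; have ik := IHd k erefl.
  have kj : msym (tperm k j) p = p by apply: adj => /=; lia.
  have -> : tperm i j = (tperm k j * tperm i k * tperm k j)%g.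
    rewrite -{1}(tpermV k j) -mulgA -conjgE tpermJ tpermL tpermD //.
      by rewrite -val_eqE /=; apply/eqP; lia.
    by rewrite -val_eqE /= e; apply/eqP; lia.
  by rewrite !mulP.
apply/issymP => s; have [ts -> _] := prod_tpermP s.
elim: ts => [|[i j] ts IHts]; first by rewrite big_nil msym1m.
rewrite big_cons mulP //=; case: (ltngtP i j) => ij.
- by apply: (tp (j - i.+1)%N); lia.
- by rewrite tpermC; apply: (tp (i - j.+1)%N); lia.
- by rewrite (val_inj ij) tperm1 msym1m.
Qed.

Definition Alt p : {mpoly rat[N]} := \sum_(s : 'S_N) (-1) ^+ s *: msym s p.

Lemma Alt_sum (I : Type) (r : seq I) (P : pred I) (F : I -> {mpoly rat[N]}) :
  Alt (\sum_(i <- r | P i) F i) = \sum_(i <- r | P i) Alt (F i).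
Proof.
rewrite /Alt exchange_big /=; apply: eq_bigr => s _.
by rewrite [msym s _]raddf_sum /= scaler_sumr.
Qed.

Lemma Alt_msym s p : Alt (msym s p) = (-1) ^+ s *: Alt p.
Proof.
rewrite /Alt scaler_sumr (reindex_inj (mulgI s^-1)%g) /=.
apply: eq_bigr => t _; rewrite -msymMm mulKVg odd_permM odd_permV scalerA.
by rewrite signr_addb.
Qed.

Lemma Alt_mulr p q : q \is symmetric -> Alt (p * q) = Alt p * q.
Proof.
move=> /issymP qs; rewrite /Alt mulr_suml; apply: eq_bigr => s _.
by rewrite msymM qs scalerAl.
Qed.

Lemma gt_hs_psize la g i j : gt N la g -> (i <= j)%N ->
  (psize (g i) <= psize (g j))%N.
Proof.
move=> [_ gh _]; apply: (@homo_leq _ (fun k => psize (g k)) leq leqnn leq_trans).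
by move=> k; apply: hs_psize.
Qed.

Lemma gt_psize la g i : gt N la g -> (psize (g i) <= psize la)%N.
Proof.
move=> gP; have [_ _ gl] := gP.
by rewrite -(gl (N + i)%N) ?leq_addr //; apply: gt_hs_psize gP _; lia.
Qed.

End Polynomials.

Lemma finite_gt N la : finite_set (gt N la).
Proof.
have := finite_fun la N (finite_parts_le (psize la)).
apply: sub_finite_set => g gP /=; split=> [i|]; last by case: gP.
exact: gt_psize gP.
Qed.

(** * Schur polynomials *)

(* [S_ N j la] is the Schur polynomial of [la] in the first [j] of [N]
   variables. *)
Definition S_ (N j : nat) (la : part) : {mpoly rat[N]} :=
  \sum_(g \in gt j la) xw N (wt g).

Lemma sym_S N la : S_ N N la \is symmetric.
Proof.
apply: issym_adjacent => i j ij; rewrite /S_.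
have c0 g k : gt N la g -> ovr (psize la) (g k) = 0%N.
  move=> gP; rewrite (ovrE _ (row_size (g k))) big1 // => l _.
  apply/eqP; rewrite subn_eq0; apply: leq_trans (leq_row_psize _ _) _.
  exact: gt_psize gP.
have iN : (i.+1 < N)%N by rewrite -ij.
set c := psize la in c0.
have fg := finite_gt N la.
rewrite fsbig_finite // [msym _ _]raddf_sum /= -!fsbig_finite //.
have tK g : gt N la g -> togg c i (togg c i g) = g by move=> gP; apply: (toggK _ _ gP).
have tP g : gt N la g -> gt N la (togg c i g) by move=> gP; apply: gt_togg gP.
symmetry; apply: (fsum_bij tP tP tK tK) => g gP.
rewrite msym_xw; apply: eq_xw => k kN; rewrite ij.
have := gt_hs_psize gP (leqnSn i); have := gt_hs_psize gP (leqnSn i.+1).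
have := gt_hs_psize (tP _ gP) (leqnSn i).
have := gt_hs_psize (tP _ gP) (leqnSn i.+1).
have noP k' : (c < row (g i.+1) k')%N -> (c < row (g i) k')%N.
  move=> lt; have := leq_trans lt (leq_trans (leq_row_psize _ _) (gt_psize i.+1 gP)).
  by rewrite ltnn.
have := psize_togg gP noP; rewrite !c0 //.
have [->|ki] := eqVneq k i; first by rewrite /wt togg_lo; lia.
have [->|ki'] := eqVneq k i.+1; first by rewrite /wt togg_hi; lia.
by rewrite wt_togg_out.
Qed.

(** * The Littlewood-Richardson rule, after Stembridge *)

(* With [g] read as a tableau, [wtcol g c i] is the number of letters [i] in
   the columns of index at least [c]. *)
Definition wtcol (g : nat -> part) (c i : nat) : nat :=
  (ovr c (g i.+1) - ovr c (g i))%N.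

Definition bad (be : part) (g : nat -> part) (c i : nat) : bool :=
  (row be i + wtcol g c i < row be i.+1 + wtcol g c i.+1)%N.

Definition dom (be : part) : set (nat -> part) :=
  [set g | forall c i, ~~ bad be g c i].

Definition delta (N k : nat) : nat := (N - k.+1)%N.

Definition alt (N : nat) (w : nat -> nat) : {mpoly rat[N]} :=
  Alt (xw N (fun k => w k + delta N k)%N).

Definition first_bad be g c i :=
  [/\ bad be g c i, forall c' i', (c < c')%N -> ~~ bad be g c' i' &
      forall i', (i' < i)%N -> ~~ bad be g c i'].

Section Stembridge.
Variables (N : nat) (la be : part).
Hypothesis beN : row be N = 0%N.

Lemma ovr_large (mu : part) c : (psize mu <= c)%N -> ovr c mu = 0%N.
Proof.
move=> muc; rewrite (ovrE _ (row_size mu)) big1 // => l _.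
by apply/eqP; rewrite subn_eq0; apply: leq_trans (leq_row_psize _ _) muc.
Qed.

Lemma bad_c g c i : gt N la g -> bad be g c i -> (c <= psize la)%N.
Proof.
move=> gP; apply: contraTT; rewrite -ltnNge => lac.
have o k : ovr c (g k) = 0%N.
  by apply: ovr_large; apply: leq_trans (ltnW lac); apply: gt_psize gP.
by rewrite /bad /wtcol !o -leqNgt !addn0 row_noninc.
Qed.

Lemma bad_i g c i : gt N la g -> bad be g c i -> (i.+1 < N)%N.
Proof.
move=> [_ _ gl]; apply: contraTT; rewrite -leqNgt => Ni.
rewrite /bad -leqNgt /wtcol (gl i.+1) // (gl i.+2) ?(leqW Ni) //.
by rewrite (row_eq0 beN) // subnn.
Qed.

Lemma first_badP g : gt N la g -> ~ dom be g ->
  exists p, first_bad be g p.1 p.2.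
Proof.
move=> gP /existsNP[c /existsNP[i /negP]]; rewrite negbK => b.
pose P c := `[< exists i, bad be g c i >].
have exP : exists c, P c by exists c; apply/asboolP; exists i.
have bP c' : P c' -> (c' <= psize la)%N by move=> /asboolP[i']; apply: bad_c.
case: (ex_maxnP exP bP) => c0 /asboolP c0P cmax.
case: (ex_minnP c0P) => i0 b0 imin; exists (c0, i0); split=> //= [c' i' lt|i' lt].
  apply: contraTN lt => b'; rewrite -leqNgt; apply: cmax.
  by apply/asboolP; exists i'.
by apply: contraTN lt => /imin; rewrite -leqNgt.
Qed.

Lemma first_bad_uniq g p q :
  first_bad be g p.1 p.2 -> first_bad be g q.1 q.2 -> p = q.
Proof.
case: p q => [c i] [c' i'] /= [b1 cm1 im1] [b2 cm2 im2].
have ec : c = c'.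
  by case: (ltngtP c c') => // lt; [move: (cm1 _ i' lt)|move: (cm2 _ i lt)];
    rewrite ?b1 ?b2.
rewrite -{}ec in b2 im2 *; congr (_, _).
by case: (ltngtP i i') => // lt; [move: (im2 _ lt)|move: (im1 _ lt)];
  rewrite ?b1 ?b2.
Qed.

Section AtFirst.
Variables (g : nat -> part) (c i : nat).
Hypotheses (gP : gt N la g) (fb : first_bad be g c i).

(* In the last failing column the letter [i.+1] occurs without [i], and the
   deficit is exactly one: with [delta] added, the entries [i] and [i.+1] of
   the partial weight agree, so that exchanging the two letters in the columns
   before it transposes these entries of the total weight. *)
Lemma first_bad_eq :
  [/\ cnt c (g i.+1) = cnt c (g i) &
      (row be i + wtcol g c i).+1 = (row be i.+1 + wtcol g c i.+1)%N].
Proof.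
have [b cm _] := fb; have := cm c.+1 i (ltnSn c); move: b.
have [_ gh _] := gP; rewrite /bad /wtcol (ovrS c (g i)) (ovrS c (g i.+1)).
rewrite (ovrS c (g i.+2)).
have := cnt_hs c (gh i); have := cnt_hs c (gh i.+1).
have := hs_ovr c.+1 (gh i); have := hs_ovr c.+1 (gh i.+1) => *; split; lia.
Qed.

Lemma first_bad_above k : (c < row (g i.+1) k)%N -> (c < row (g i) k)%N.
Proof. by have [e _] := first_bad_eq; rewrite -!ltn_cnt e. Qed.

Lemma first_bad_togg : first_bad be (togg c i g) c i.
Proof.
have [b cm im] := fb.
have wc c' k : (c <= c')%N -> wtcol (togg c i g) c' k = wtcol g c' k.
  by move=> cc; rewrite /wtcol !(ovr_togg i gP).
have badE c' k : (c <= c')%N -> bad be (togg c i g) c' k = bad be g c' k.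
  by move=> cc; rewrite /bad !wc.
split=> [|c' i' lt|i' lt]; rewrite badE ?(ltnW lt) //; first exact: cm.
exact: im.
Qed.

Lemma alt_togg :
  alt N (fun k => row be k + wt (togg c i g) k)%N =
  - alt N (fun k => row be k + wt g k)%N.
Proof.
have iN : (i.+1 < N)%N by have [b _ _] := fb; apply: bad_i gP b.
have tP : gt N la (togg c i g) by apply: gt_togg.
pose i0 := Ordinal (ltnW iN); pose i1 := Ordinal iN.
rewrite -scaleN1r -[-1]/((-1) ^+ true).
have -> : true = tperm i0 i1 :> bool.
  by rewrite odd_tperm -val_eqE /=; apply/esym/eqP; lia.
rewrite /alt -Alt_msym; congr Alt; rewrite msym_xw; apply: eq_xw => k kN /=.
have [_ e] := first_bad_eq.
have := gt_hs_psize gP (leqnSn i); have := gt_hs_psize gP (leqnSn i.+1).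
have := gt_hs_psize tP (leqnSn i); have := gt_hs_psize tP (leqnSn i.+1).
have [_ gh _] := gP.
have := hs_ovr c (gh i); have := hs_ovr c (gh i.+1).
have := psize_togg gP first_bad_above; move: e; rewrite /wtcol.
have [->|ki] := eqVneq k i; first by rewrite /delta /wt togg_lo; lia.
have [->|ki'] := eqVneq k i.+1; first by rewrite /delta /wt togg_hi; lia.
by rewrite wt_togg_out.
Qed.

End AtFirst.

Lemma alt_bad_eq0 :
  \sum_(g \in gt N la `&` ~` dom be) alt N (fun k => row be k + wt g k)%N = 0.
Proof.
set B := _ `&` _; set F := fun g => alt N _.
pose sel g : nat * nat := xget (0, 0)%N [set p | first_bad be g p.1 p.2].
pose t g := togg (sel g).1 (sel g).2 g.
have selP g : B g -> first_bad be g (sel g).1 (sel g).2.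
  case=> gP /(first_badP gP) ex.
  exact: (@xgetPex _ (0, 0)%N [set p | first_bad be g p.1 p.2] ex).
have tB g : B g -> B (t g).
  move=> Bg; have fb := selP g Bg; have [gP _] := Bg.
  have [b0 _ _] := fb; split; first exact: gt_togg (bad_i gP b0) gP.
  have [b _ _] := first_bad_togg gP fb.
  by move=> d; move: (d (sel g).1 (sel g).2); rewrite b.
have tK g : B g -> t (t g) = g.
  move=> Bg; have fb := selP g Bg; have [gP _] := Bg.
  rewrite {1}/t (_ : sel (t g) = sel g); first exact: (toggK _ _ gP).
  exact: first_bad_uniq (selP _ (tB _ Bg)) (first_bad_togg gP fb).
have fB : finite_set B by apply: finite_setI; left; apply: finite_gt.
have e : \sum_(g \in B) F g = \sum_(g \in B) (- F g).
  apply: (fsum_bij tB tB tK tK) => g Bg; have [gP _] := Bg.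
  exact: alt_togg gP (selP g Bg).
have {}e : \sum_(g \in B) F g = - \sum_(g \in B) F g.
  by rewrite {1}e !fsbig_finite //= sumrN.
apply/eqP; move/eqP: e; rewrite -addr_eq0 -mulr2n -scaler_nat scaler_eq0.
by rewrite pnatr_eq0.
Qed.

Lemma alt_mul_S :
  alt N (row be) * S_ N N la =
  \sum_(g \in gt N la `&` dom be) alt N (fun k => row be k + wt g k)%N.
Proof.
have fg := finite_gt N la.
rewrite /alt -Alt_mulr ?sym_S // /S_ fsbig_finite // mulr_sumr Alt_sum.
rewrite -fsbig_finite // (fsbigID (dom be)) //=.
rewrite [X in _ + X = _](_ : _ = 0) ?addr0; last first.
  rewrite -[RHS]alt_bad_eq0; apply: eq_fsbigr => g _.
  by rewrite /alt -xwD; congr Alt; apply: eq_xw => k _; rewrite addnAC.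
apply: eq_fsbigr => g _.
by rewrite /alt -xwD; congr Alt; apply: eq_xw => k _; rewrite addnAC.
Qed.

End Stembridge.

Definition gstd (la : part) (i : nat) : part :=
  ofrow (fun k => if (k < i)%N then row la k else 0%N).

Lemma row_gstd la i k : row (gstd la i) k = if (k < i)%N then row la k else 0%N.
Proof.
apply: (@row_ofrow _ i) => {}k; last by rewrite leqNgt => /negbTE ->.
by have := row_noninc la (leqnSn k); case: (ltnP k i); case: (ltnP k.+1 i); lia.
Qed.

Lemma ovr_gstd c la i : ovr c (gstd la i) = (\sum_(k < i) (row la k - c))%N.
Proof.
rewrite (@ovrE _ _ i); last by rewrite row_gstd ltnn.
by apply: eq_bigr => k _; rewrite row_gstd ltn_ord.
Qed.

Lemma gt_gstd N la : row la N = 0%N -> gt N la (gstd la).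
Proof.
move=> laN; split=> [|i k|i Ni].
- by apply: part_ext => k; rewrite row_gstd row0.
- rewrite !row_gstd; have := row_noninc la (leqnSn k).
  by rewrite [(k.+1 < i.+1)%N]ltnS; case: (ltnP k i); case: (ltnP k i.+1); lia.
apply: part_ext => k; rewrite row_gstd; case: ltnP => // ik.
by rewrite (row_eq0 laN) // (leq_trans Ni).
Qed.

Lemma wtcol_gstd c la i : wtcol (gstd la) c i = (row la i - c)%N.
Proof. by rewrite /wtcol !ovr_gstd big_ord_recr /= addKn. Qed.

Lemma dom_gstd la : dom empty_part (gstd la).
Proof.
move=> c i; rewrite /bad !row0 !wtcol_gstd -leqNgt.
by have := row_noninc la (leqnSn i); lia.
Qed.

Lemma wtcol0 g i : wtcol g 0 i = wt g i.
Proof. by rewrite /wtcol !ovr0. Qed.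

Lemma cnt_large (mu : part) c : (psize mu <= c)%N -> cnt c mu = 0%N.
Proof.
move=> muc; apply/eqP; rewrite -leqn0 leqNgt ltn_cnt -leqNgt.
exact: leq_trans (leq_row_psize _ _) muc.
Qed.

Lemma cnt_gt N la g c i : gt N la g -> (cnt c (g i) <= cnt c la)%N.
Proof.
move=> [_ gh gl]; rewrite -(gl (N + i)%N) ?leq_addr // addnC.
elim: N {gl} => [|N IHN]; first by rewrite addn0.
by apply: leq_trans IHN _; rewrite addnS; have /andP[] := cnt_hs c (gh (i + N)%N).
Qed.

Lemma cnt_gt_le N la g c i : gt N la g -> (cnt c (g i) <= i)%N.
Proof.
move=> [g0 gh _]; elim: i => [|i IHi]; first by rewrite g0.
by have /andP[_ h] := cnt_hs c (gh i); apply: leq_trans h _.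
Qed.

Lemma leq_cnt c la : (cnt c.+1 la <= cnt c la)%N.
Proof. by apply: sub_count => x /=; apply: ltnW. Qed.

Lemma cnt_dom_empty N la g c : gt N la g -> dom empty_part g ->
  (forall i, cnt c (g i) = minn i (cnt c la)) /\
  (forall i, wtcol g c i = row la i - c)%N.
Proof.
move=> gP gd; have [g0 gh gl] := gP.
have [n cn] : exists n, (psize la - c <= n)%N by exists (psize la - c)%N.
elim: n c cn => [|n IHn] c cn.
  have lac : (psize la <= c)%N by lia.
  have glac i := leq_trans (gt_psize i gP) lac.
  split=> i; first by rewrite !cnt_large // minn0.
  rewrite /wtcol !ovr_large // subnn.
  by have := leq_row_psize la i; lia.
have {IHn} [IHc IHw] : (forall i, cnt c.+1 (g i) = minn i (cnt c.+1 la)) /\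
  (forall i, wtcol g c.+1 i = row la i - c.+1)%N by apply: IHn; lia.
have step i : (cnt c (g i) <= cnt c (g i.+1) <= (cnt c (g i)).+1)%N.
  exact: cnt_hs.
have wE i : wtcol g c i =
    (row la i - c.+1 + (cnt c (g i.+1) - cnt c (g i)))%N.
  rewrite -IHw /wtcol !(ovrS c).
  by have := hs_ovr c.+1 (gh i); have := step i; lia.
have cE i : cnt c (g i) = minn i (cnt c la).
  elim: i => [|i IHi]; first by rewrite g0 min0n.
  have := IHc i.+1; have := leq_cnt c (g i.+1); have := leq_cnt c la.
  have := cnt_gt c i.+1 gP; have := cnt_gt_le c i.+1 gP.
  have := step i; case: (ltnP i (cnt c.+1 la)) => [|Li]; first by lia.
  have [d0|d1] := eqVneq (cnt c (g i.+1)) (cnt c (g i)); last by lia.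
  suff : cnt c la = cnt c (g i) by lia.
  have nz j : (i <= j)%N -> (row la j <= c.+1)%N.
    by move=> ij; rewrite leqNgt -ltn_cnt -leqNgt; apply: leq_trans ij.
  have d j : (cnt c (g (i + j).+1%N) <= cnt c (g (i + j)%N))%N.
    elim: j => [|j IHj]; first by rewrite addn0 d0.
    have := gd c (i + j)%N; rewrite /bad !row0 !wE.
    have := nz (i + j)%N; have := nz (i + j).+1; rewrite addnS; lia.
  have e j : cnt c (g (i + j)%N) = cnt c (g i).
    elim: j => [|j IHj]; first by rewrite addn0.
    by rewrite addnS -IHj; have := d j; have := step (i + j)%N; lia.
  by rewrite -(e N) gl // leq_addl.
split=> // i; rewrite wE !cE; have := ltn_cnt c la i.
by case: (ltnP c (row la i)); case: (ltnP i (cnt c la)); lia.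
Qed.

Lemma gt_dom_empty N la : row la N = 0%N ->
  gt N la `&` dom empty_part = [set gstd la].
Proof.
move=> laN; apply/seteqP; split=> [g [gP gd]|_ ->] /=; last first.
  by split; [exact: gt_gstd | exact: dom_gstd].
apply/funext => i; apply: part_ext => k; rewrite row_gstd.
have lt c : (c < row (g i) k)%N = (k < i)%N && (c < row la k)%N.
  have [cE _] := cnt_dom_empty c gP gd.
  by rewrite -!ltn_cnt cE leq_min.
case: (ltnP k i) lt => _ /= lt; last first.
  by case: (row (g i) k) lt => // r /(_ 0%N).
by apply/eqP; rewrite eqn_leq leqNgt lt ltnn leqNgt -lt ltnn.
Qed.

Definition vdm N : {mpoly rat[N]} := alt N (row empty_part).

Lemma eq_alt N w1 w2 : (forall i, (i < N)%N -> w1 i = w2 i) -> alt N w1 = alt N w2.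
Proof. by move=> e; rewrite /alt; congr Alt; apply: eq_xw => i /e ->. Qed.

Lemma vdm_mul_S N la : row la N = 0%N -> vdm N * S_ N N la = alt N (row la).
Proof.
move=> laN; rewrite /vdm alt_mul_S ?row0 // gt_dom_empty // fsbig_set1.
apply: eq_alt => i _; rewrite row0 add0n -wtcol0 wtcol_gstd subn0 //.
Qed.

Lemma perm_decreasing N (m k : 'X_{1..N}) (s : 'S_N) :
  (forall i j : 'I_N, (i < j)%N -> (m j < m i)%N) ->
  (forall i j : 'I_N, (i < j)%N -> (k j < k i)%N) ->
  m = [multinom k (s i) | i < N] -> m = k /\ s = 1%g.
Proof.
move=> md kd e; have ms i : m i = k (s i) by rewrite e mnmE.
have srt (u : 'X_{1..N}) : (forall i j : 'I_N, (i < j)%N -> (u j < u i)%N) ->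
    sorted gtn [seq u i | i <- enum 'I_N].
  move=> ud; rewrite sorted_map.
  have : sorted (relpre val ltn) (enum 'I_N).
    by rewrite -sorted_map val_enum_ord iota_ltn_sorted.
  by apply: sub_sorted => i j /=; apply: ud.
have pk : perm_eq [seq m i | i <- enum 'I_N] [seq k i | i <- enum 'I_N].
  have -> : [seq m i | i <- enum 'I_N] = [seq k i | i <- [seq s i | i <- enum 'I_N]].
    by rewrite -[RHS]map_comp; apply: eq_map => i /=; rewrite ms.
  apply: perm_map; apply: uniq_perm; rewrite ?(map_inj_uniq (@perm_inj _ s)) ?enum_uniq //.
  by move=> i; rewrite mem_enum inE -[i](permKV s) map_f ?mem_enum.
have tr : transitive gtn by move=> a b c ab bc; apply: ltn_trans bc ab.
have asym : antisymmetric gtn by move=> a b; rewrite /=; lia.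
have /(sorted_eq tr asym (srt m md) (srt k kd)) em := pk.
have mk : m = k.
  apply/mnmP => i; have := congr1 (fun u => nth 0%N u i) em.
  have iN : (i < size (enum 'I_N))%N by rewrite size_enum_ord.
  by rewrite (nth_map i 0%N m iN) (nth_map i 0%N k iN) nth_ord_enum.
split=> //; apply/permP => i; rewrite perm1; apply: val_inj => /=.
have := ms i; rewrite mk.
by case: (ltngtP (s i) i) => // /kd + h; rewrite h ltnn.
Qed.

Lemma mcoeff_alt N (la mu : part) : row la N = 0%N -> row mu N = 0%N ->
  (alt N (row mu))@_(mon N (fun k => row la k + delta N k)%N) = (la == mu)%:R.
Proof.
move=> laN muN.
have dec (nu : part) : forall i j : 'I_N, (i < j)%N ->
    (mon N (fun k => row nu k + delta N k)%N j <
     mon N (fun k => row nu k + delta N k)%N i)%N.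
  move=> i j ij; rewrite !mnmE /delta /=.
  by have := row_noninc nu (ltnW ij); have := ltn_ord j; lia.
rewrite /alt /Alt raddf_sum /= (bigD1 1%g) //= big1 ?addr0 => [|s s1].
  rewrite mcoeffZ odd_perm1 mul1r msym1m mcoeffX; congr (_%:R); congr nat_of_bool.
  apply/eqP/eqP => [e|-> //]; apply: part_ext => k.
  case: (ltnP k N) => kN; last by rewrite !(row_eq0 _ kN).
  by have /mnmP/(_ (Ordinal kN)) := e; rewrite !mnmE /=; lia.
rewrite mcoeffZ mcoeff_sym mcoeffX; case: eqP => [e|_]; last by rewrite mulr0.
by have [_ e1] := perm_decreasing (dec mu) (dec la) e; rewrite e1 eqxx in s1.
Qed.

Lemma vdm_neq0 N : vdm N != 0.
Proof.
apply/eqP => /(congr1 (mcoeff (mon N (fun k => row empty_part k + delta N k)%N))).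
by rewrite /vdm mcoeff_alt ?row0 // eqxx mcoeff0 => /eqP; rewrite oner_eq0.
Qed.

Definition coord N (nu : part) (p : {mpoly rat[N]}) : rat :=
  (vdm N * p)@_(mon N (fun k => row nu k + delta N k)%N).

Lemma coord_S N nu mu : row nu N = 0%N -> row mu N = 0%N ->
  coord nu (S_ N N mu) = (nu == mu)%:R.
Proof. by move=> nuN muN; rewrite /coord vdm_mul_S // mcoeff_alt. Qed.

Definition addw (be : part) (g : nat -> part) : part :=
  ofrow (fun k => row be k + wt g k)%N.

Lemma wt_ge N la g i : gt N la g -> (N <= i)%N -> wt g i = 0%N.
Proof. by move=> [_ _ gl] Ni; rewrite /wt !gl ?subnn // ltnW. Qed.

Lemma row_addw N be la g k : row be N = 0%N -> gt N la g -> dom be g ->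
  row (addw be g) k = (row be k + wt g k)%N.
Proof.
move=> beN gP gd; apply: (@row_ofrow _ N) => {}k.
  by have := gd 0%N k; rewrite /bad -leqNgt !wtcol0.
by move=> Nk; rewrite (row_eq0 beN) // (wt_ge gP).
Qed.

Lemma S_mul N be la : row be N = 0%N ->
  S_ N N be * S_ N N la = \sum_(g \in gt N la `&` dom be) S_ N N (addw be g).
Proof.
move=> beN; apply: (mulfI (vdm_neq0 N)).
have fgd : finite_set (gt N la `&` dom be).
  by apply: finite_setI; left; apply: finite_gt.
rewrite mulrA vdm_mul_S // alt_mul_S // fsbig_distrr //.
apply: eq_fsbigr => g; rewrite inE => -[gP gd].
have rE k := row_addw k beN gP gd.
rewrite /= vdm_mul_S; first by apply: eq_alt => k _; rewrite rE.
by rewrite rE beN (wt_ge gP).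
Qed.

Lemma fsum_dep (T U : choiceType) (R : nmodType) (A : set T) (B : T -> set U)
    (F : T -> U -> R) :
  finite_set A -> finite_set [set p | A p.1 /\ B p.1 p.2] ->
  \sum_(x \in A) \sum_(y \in B x) F x y =
  \sum_(p \in [set p | A p.1 /\ B p.1 p.2]) F p.1 p.2.
Proof.
move=> fA fAB; rewrite (fsum_fibers (p := fst) _ fAB fA); last by move=> p [].
apply: eq_fsbigr => x; rewrite inE => Ax.
apply: (@fsum_bij _ _ _ _ _ (fun p => p.2) (fun y => (x, y))) => //.
- by move=> [x' y] /= [[_ By] <-].
- by move=> [x' y] /= [[_ By] ->].
- by move=> [x' y] /= [[_ By] ->].
Qed.

Lemma finite_parts2 n : finite_set
  [set p : part * part | (psize p.1 <= n)%N /\ (psize p.2 <= n)%N].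
Proof. exact: finite_setX (finite_parts_le n) (finite_parts_le n). Qed.

Section Recursion.
Variable N : nat.

Definition xv (j a : nat) : {mpoly rat[N]} := xw N (fun i => (i == j) * a)%N.

Lemma xvD j a b : xv j (a + b) = xv j a * xv j b.
Proof. by rewrite /xv -xwD; apply: eq_xw => i _; rewrite mulnDr. Qed.

Lemma finite_hs_down la : finite_set [set rho | hs la rho].
Proof. by apply: sub_finite_set (finite_parts_le (psize la)) => rho /= /hs_psize. Qed.

Lemma finite_hs_up rho a :
  finite_set [set ka | hs ka rho /\ psize ka = (psize rho + a)%N].
Proof.
by apply: sub_finite_set (finite_parts_le (psize rho + a)) => ka /= [_ ->].
Qed.

Definition glue (T : Type) (j : nat) (la : T) (g : nat -> T) (i : nat) : T :=
  if (i <= j)%N then g i else la.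

Lemma S_branch j la :
  S_ N j.+1 la =
  \sum_(rho \in [set rho | hs la rho]) xv j (psize la - psize rho) * S_ N j rho.
Proof.
rewrite /S_ (@fsum_fibers _ _ _ _ [set rho | hs la rho] (fun g => g j)).
- apply: eq_fsbigr => rho; rewrite inE => lr.
  rewrite fsbig_distrr; last exact: finite_gt.
  apply: (@fsum_bij _ _ _ _ _ (glue j la) (glue j rho)).
  + move=> g [g0 gh gl] /=; split; last by rewrite /glue leqnn gl.
    split=> [|i|i ji]; rewrite /glue //; last by rewrite leqNgt ji.
    case: (ltngtP i j) => [ij|ij|->] //=; [exact: hs_refl|].
    by rewrite gl.
  + move=> g [[g0 gh gl] gj]; split=> [|i|i ji]; rewrite /glue //.
      case: (ltngtP i j) => [ij|ij|->] //=; first exact: hs_refl.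
      by rewrite gj; apply: hs_refl.
    by case: (ltngtP i j) ji => // -> _.
  + move=> g [g0 gh gl]; apply/funext => i; rewrite /glue.
    by case: leqP => // ji; rewrite gl // ltnW.
  + move=> g [[g0 gh gl] gj]; apply/funext => i; rewrite /glue.
    by case: leqP => // ji; rewrite gl.
  + move=> g [g0 gh gl] /=; rewrite /xv -xwD; apply: eq_xw => i _.
    rewrite /wt /glue; case: (ltngtP i j) => [ij|ij|->] /=.
    * by rewrite mul0n.
    * by rewrite mul0n !gl ?subnn // ltnW // ltnW.
    * by rewrite gl // gl // subnn addn0 mul1n.
- exact: finite_gt.
- exact: finite_hs_down.
- by move=> g [g0 gh gl] /=; rewrite -(gl j.+1).
Qed.

Lemma S_0 la : S_ N 0 la = (la == empty_part)%:R.
Proof.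
rewrite /S_; have [->|la0] := eqVneq la empty_part.
  rewrite (_ : gt 0 empty_part = [set (fun=> empty_part)]).
    by rewrite fsbig_set1 /xw -[RHS]mpolyX0; congr 'X_[_]; apply/mnmP => i;
      rewrite mnmE mnm0E /wt subnn.
  apply/seteqP; split=> [g [_ _ gl]|_ ->] /=; first by apply/funext => i; apply: gl.
  by split=> // i; apply: hs_refl.
rewrite (_ : gt 0 la = set0) ?fsbig_set0 //; apply/seteqP; split=> // g [g0 _ gl].
by move/eqP: la0 => []; rewrite -(gl 0%N).
Qed.

(* The complete homogeneous polynomial of degree [a] in the first [j]
   variables. *)
Fixpoint hp (j a : nat) : {mpoly rat[N]} :=
  if j is j'.+1 then \sum_(b < a.+1) xv j' (a - b) * hp j' b else (a == 0%N)%:R.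

Lemma psize_reflect (rho sg ta ka : part) :
  hs ka rho -> hs ka sg ->
  (forall k, row ka k.+1 + row ta k =
     maxn (row rho k.+1) (row sg k.+1) + minn (row rho k) (row sg k))%N ->
  (psize ka + psize ta + maxn (row rho 0) (row sg 0) =
   psize rho + psize sg + row ka 0)%N.
Proof.
move=> kr ks e.
have k0 := row_size ka; have k0S := row_eq0 k0 (leqnSn _).
have r0 := hs_row0 kr k0; have s0 := hs_row0 ks k0.
have t0 : row ta (size ka) = 0%N.
  have := e (size ka); rewrite k0S r0 s0.
  by rewrite (row_eq0 r0 (leqnSn _)) (row_eq0 s0 (leqnSn _)); lia.
rewrite (psizeE k0) (psizeE t0) (psizeE r0) (psizeE s0).
have H n : (\sum_(k < n) row ka k + \sum_(k < n) row ta k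
    + maxn (row rho 0) (row sg 0) + row ka n =
    \sum_(k < n) row rho k + \sum_(k < n) row sg k + row ka 0
    + maxn (row rho n) (row sg n))%N.
  elim: n => [|n IHn]; first by rewrite !big_ord0; lia.
  by rewrite !big_ord_recr /=; move: IHn (e n) => /=; lia.
by have := H (size ka); rewrite k0 r0 s0; lia.
Qed.

Definition pieri_dn (rho sg ka : part) : part :=
  ofrow (fun k => maxn (row rho k.+1) (row sg k.+1) + minn (row rho k) (row sg k)
                  - row ka k.+1)%N.

Definition pieri_up (a : nat) (rho sg ta : part) : part :=
  ofrow (fun k => if k is l.+1 then
      maxn (row rho l.+1) (row sg l.+1) + minn (row rho l) (row sg l) - row ta l
    else maxn (row rho 0) (row sg 0) + (a + psize ta - psize sg))%N.

Lemma row_pieri_dn rho sg ka k : hs ka rho -> hs ka sg ->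
  (row (pieri_dn rho sg ka) k + row ka k.+1 =
  maxn (row rho k.+1) (row sg k.+1) + minn (row rho k) (row sg k))%N.
Proof.
move=> kr ks; rewrite (@row_ofrow _ (size rho)).
- by have [? ?] := kr k; have [? ?] := ks k; have [? ?] := kr k.+1;
  have [? ?] := ks k.+1; lia.
- move=> {}k; have [? ?] := kr k; have [? ?] := ks k; have [? ?] := kr k.+1.
  by have [? ?] := ks k.+1; have [? ?] := kr k.+2; have [? ?] := ks k.+2; lia.
move=> {}k rk; have r0 := row_eq0 (row_size rho) rk.
have rk' := row_eq0 (row_size rho) (leqW rk).
by have [? ?] := kr k.+1; have [? ?] := ks k.+1; rewrite r0 rk'; lia.
Qed.

Lemma row_pieri_up a rho sg ta : hs rho ta -> hs sg ta ->
  (forall k, row (pieri_up a rho sg ta) k.+1 + row ta k =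
   maxn (row rho k.+1) (row sg k.+1) + minn (row rho k) (row sg k))%N /\
  row (pieri_up a rho sg ta) 0 =
    (maxn (row rho 0) (row sg 0) + (a + psize ta - psize sg))%N.
Proof.
move=> rt st.
have rE k : row (pieri_up a rho sg ta) k = if k is l.+1 then
      (maxn (row rho l.+1) (row sg l.+1) + minn (row rho l) (row sg l) - row ta l)%N
    else (maxn (row rho 0) (row sg 0) + (a + psize ta - psize sg))%N.
  apply: (@row_ofrow _ (size rho).+1) => {}k.
    case: k => [|k]; first by have [? ?] := rt 0%N; have [? ?] := st 0%N; lia.
    by have [? ?] := rt k; have [? ?] := st k; have [? ?] := rt k.+1;
       have [? ?] := st k.+1; lia.
  case: k => // k rk; have r0 := row_eq0 (row_size rho) rk.
  have rk' := row_eq0 (row_size rho) (leqW rk).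
  by have [? ?] := rt k; have [? ?] := st k; rewrite r0 rk'; lia.
split=> [k|]; last by rewrite rE.
by rewrite rE; have [? ?] := rt k; have [? ?] := st k; lia.
Qed.

Lemma hs_pieri_dn rho sg ka : hs ka rho -> hs ka sg ->
  hs rho (pieri_dn rho sg ka) /\ hs sg (pieri_dn rho sg ka).
Proof.
move=> kr ks; split=> k; have := row_pieri_dn k kr ks;
  by have [? ?] := kr k; have [? ?] := ks k; have [? ?] := kr k.+1;
     have [? ?] := ks k.+1; lia.
Qed.

Lemma hs_pieri_up a rho sg ta : hs rho ta -> hs sg ta ->
  hs (pieri_up a rho sg ta) rho /\ hs (pieri_up a rho sg ta) sg.
Proof.
move=> rt st; have [rE r0] := row_pieri_up a rt st.
split=> -[|k]; have [? ?] := rt 0%N; have [? ?] := st 0%N; have := rE 0%N;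
  try have := rE k; try have := rE k.+1; try have [? ?] := rt k;
  try have [? ?] := st k; try have [? ?] := rt k.+1; try have [? ?] := st k.+1; lia.
Qed.

Lemma pieri_S j a rho :
  hp j a * S_ N j rho =
  \sum_(ka \in [set ka | hs ka rho /\ psize ka = (psize rho + a)%N]) S_ N j ka.
Proof.
elim: j a rho => [|j IHj] a rho.
  rewrite S_0 /=; have [->|a0] := eqVneq a 0%N.
    rewrite mul1r (_ : [set _ | _] = [set rho]) ?fsbig_set1 ?S_0 //.
    apply/seteqP; split=> [ka [kr e]|_ ->] /=; last first.
      by split; [exact: hs_refl | rewrite addn0].
    by apply: hs_psize_eq kr _; rewrite e addn0.
  rewrite mul0r fsbig1 // => ka [_ e]; rewrite S_0; case: eqP => // ke.
  by move: e; rewrite ke psize_empty; lia.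
transitivity (\sum_(p \in [set p : part * part | hs rho p.1 /\
     (hs p.2 p.1 /\ (psize p.2 <= psize p.1 + a)%N)])
   xv j (a + psize rho - psize p.2) * S_ N j p.2).
  rewrite -(@fsum_dep _ _ _ [set ta | hs rho ta]
    (fun ta => [set sg | hs sg ta /\ (psize sg <= psize ta + a)%N])
    (fun ta sg => xv j (a + psize rho - psize sg) * S_ N j sg)); last 2 first.
  - exact: finite_hs_down.
  - apply: sub_finite_set (finite_parts2 (psize rho + a)) => p /= [/hs_psize r [_ s]].
    by split; [apply: leq_trans r _; rewrite leq_addr|apply: leq_trans s _; rewrite leq_add2r].
  rewrite S_branch fsbig_distrr; last exact: finite_hs_down.
  apply: eq_fsbigr => ta; rewrite inE => /hs_psize rt /=.
  rewrite mulr_suml (@fsum_fibers _ _ _ _ `I_a.+1 (fun sg => psize sg - psize ta)%N).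
  - rewrite -fsbig_ord; apply: eq_bigr => b _.
    rewrite mulrACA IHj fsbig_distrr; last exact: finite_hs_up.
    rewrite -xvD /=.
    rewrite (_ : [set ka | _] = [set sg | (hs sg ta /\ (psize sg <= psize ta + a)%N) /\
       (psize sg - psize ta)%N = b]).
      apply: eq_fsbigr => sg; rewrite inE => -[[/hs_psize h1 h2] h3].
      by congr (xv _ _ * _); lia.
    have bl := ltn_ord b.
    apply/seteqP; split=> sg /=; first by move=> [h e]; split; [split=> //|]; lia.
    by move=> [[h e] e']; split=> //; have := hs_psize h; lia.
  - by apply: sub_finite_set (finite_parts_le (psize ta + a)) => sg [].
  - exact: finite_II.
  - by move=> sg [h le] /=; lia.
transitivity (\sum_(p \in [set p : part * part |
     (hs p.1 rho /\ psize p.1 = (psize rho + a)%N) /\ hs p.1 p.2])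
   xv j (psize p.1 - psize p.2) * S_ N j p.2); last first.
  rewrite -(@fsum_dep _ _ _ [set ka | hs ka rho /\ psize ka = (psize rho + a)%N]
    (fun ka => [set sg | hs ka sg])
    (fun ka sg => xv j (psize ka - psize sg) * S_ N j sg)).
  - by apply: eq_fsbigr => ka _; rewrite S_branch.
  - exact: finite_hs_up.
  - apply: sub_finite_set (finite_parts2 (psize rho + a)) => p /= [[h e] /hs_psize h'].
    by rewrite -e leqnn h'.
apply: (@fsum_bij _ _ _ _ _ (fun p => (pieri_dn rho p.2 p.1, p.2))
          (fun p => (pieri_up a rho p.2 p.1, p.2))).
- move=> [ka sg] /= [[kr e] ks]; have rE k := row_pieri_dn k kr ks.
  have [rt st] := hs_pieri_dn kr ks; split=> //; split=> //.
  have := psize_reflect kr ks (fun k => etrans (addnC _ _) (rE k)).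
  by have [? ?] := kr 0%N; have [? ?] := ks 0%N; lia.
- move=> [ta sg] /= [rt [st le]]; have [rE r0] := row_pieri_up a rt st.
  have [kr ks] := hs_pieri_up a rt st; split=> //; split=> //.
  by have := psize_reflect kr ks rE; rewrite r0; lia.
- move=> [ka sg] /= [[kr e] ks]; congr (_, _); apply: part_ext => k.
  have rE k' := row_pieri_dn k' kr ks; have [rt st] := hs_pieri_dn kr ks.
  have [rE' r0] := row_pieri_up a rt st.
  case: k => [|k]; last by have := rE k; have := rE' k; lia.
  rewrite r0; have := psize_reflect kr ks (fun k => etrans (addnC _ _) (rE k)).
  by have [? ?] := kr 0%N; have [? ?] := ks 0%N; lia.
- move=> [ta sg] /= [rt [st le]]; congr (_, _); apply: part_ext => k.
  have [rE r0] := row_pieri_up a rt st; have [kr ks] := hs_pieri_up a rt st.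
  by have := row_pieri_dn k kr ks; have := rE k; lia.
- by move=> [ka sg] /= [[kr e] ks]; rewrite e addnC.
Qed.

End Recursion.

Definition even_part (be : part) : Prop :=
  forall k, row be k.*2 = row be k.*2.+1.

Definition evens (d : nat) : set part := [set be | even_part be /\ psize be = d].

Definition even_up (bt : part) : part := ofrow (fun k => row bt k./2.*2).

Definition even_dn (bt : part) : part := ofrow (fun k => row bt k./2.*2.+1).

Lemma row_even_up bt k : row (even_up bt) k = row bt k./2.*2.
Proof.
apply: (@row_ofrow _ (size bt).*2) => {}k; first by apply: row_noninc; lia.
by move=> bk; apply: row_eq0 (row_size bt) _; lia.
Qed.

Lemma row_even_dn bt k : row (even_dn bt) k = row bt k./2.*2.+1.
Proof.
apply: (@row_ofrow _ (size bt).*2) => {}k; first by apply: row_noninc; lia.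
by move=> bk; apply: row_eq0 (row_size bt) _; lia.
Qed.

Lemma even_part_up bt : even_part (even_up bt).
Proof. by move=> k; rewrite !row_even_up; congr row; lia. Qed.

Lemma even_part_dn bt : even_part (even_dn bt).
Proof. by move=> k; rewrite !row_even_dn; congr row; lia. Qed.

Lemma hs_even_up bt : hs (even_up bt) bt.
Proof. by move=> k; rewrite !row_even_up !row_noninc //; lia. Qed.

Lemma hs_even_dn bt : hs bt (even_dn bt).
Proof. by move=> k; rewrite !row_even_dn !row_noninc //; lia. Qed.

Lemma parityP k : k = k./2.*2 \/ k = k./2.*2.+1.
Proof. lia. Qed.

Lemma even_up_uniq be bt : even_part be -> hs be bt -> be = even_up bt.
Proof.
move=> ev h; apply: part_ext => k; rewrite row_even_up.
case: (parityP k); move: k./2 => i ->; have := ev i; have [] := h i.*2; lia.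
Qed.

Lemma even_dn_uniq ga bt : even_part ga -> hs bt ga -> ga = even_dn bt.
Proof.
move=> ev h; apply: part_ext => k; rewrite row_even_dn.
case: (parityP k); move: k./2 => i ->; have := ev i; have [] := h i.*2;
  have [] := h i.*2.+1; lia.
Qed.

Lemma psize_even bt : (psize (even_up bt) + psize (even_dn bt) = (psize bt).*2)%N.
Proof.
pose n := size bt; have e0 : row bt n.*2 = 0%N.
  by apply: row_eq0 (row_size bt) _; rewrite -addnn leq_addr.
have u0 : row (even_up bt) n.*2 = 0%N by rewrite row_even_up doubleK.
have d0 : row (even_dn bt) n.*2 = 0%N.
  by rewrite row_even_dn doubleK; apply: row_eq0 e0 _.
rewrite (psizeE e0) (psizeE u0) (psizeE d0); elim: {e0 u0 d0} n => [|n IHn].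
  by rewrite !big_ord0.
rewrite doubleS !big_ord_recr /= !row_even_up !row_even_dn /=.
by rewrite uphalf_double doubleK; move: IHn => /=; lia.
Qed.

Lemma finite_evens d : finite_set (evens d).
Proof. by apply: sub_finite_set (finite_parts_le d) => be [_ <-] /=. Qed.

Lemma finite_double d : finite_set [set a | (a.*2 <= d)%N].
Proof. by apply: sub_finite_set (finite_II d.+1) => a /=; lia. Qed.

Definition E_ (N j d : nat) : {mpoly rat[N]} := \sum_(be \in evens d) S_ N j be.

Lemma E_branch N j d : E_ N j.+1 d =
  \sum_(a \in [set a | (a.*2 <= d)%N]) xv N j a * (hp N j a * E_ N j (d - a.*2)).
Proof.
transitivity (\sum_(p \in [set p : part * part | evens d p.1 /\ hs p.1 p.2])
    xv N j (psize p.1 - psize p.2) * S_ N j p.2).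
  rewrite -(@fsum_dep _ _ _ (evens d) (fun be => [set bt | hs be bt])
    (fun be bt => xv N j (psize be - psize bt) * S_ N j bt)).
  - by apply: eq_fsbigr => be _; rewrite S_branch.
  - exact: finite_evens.
  - by apply: sub_finite_set (finite_parts2 d) => p /= [[_ <-] /hs_psize h].
transitivity (\sum_(q \in [set q : nat * (part * part) | (q.1.*2 <= d)%N /\
      (evens (d - q.1.*2) q.2.1 /\
       (hs q.2.2 q.2.1 /\ psize q.2.2 = (psize q.2.1 + q.1)%N))])
    xv N j q.1 * S_ N j q.2.2); last first.
  rewrite -(@fsum_dep _ _ _ [set a | (a.*2 <= d)%N]
    (fun a => [set p | evens (d - a.*2) p.1 /\
       (hs p.2 p.1 /\ psize p.2 = (psize p.1 + a)%N)])
    (fun a p => xv N j a * S_ N j p.2)); last 2 first.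
  - exact: finite_double.
  - apply: sub_finite_set (finite_setX (finite_double d) (finite_parts2 d)).
    by move=> [a [ga bt]] /= [ad [[_ e1] [_ e2]]]; do 2!split=> //=; lia.
  apply: eq_fsbigr => a; rewrite inE /= => ad; rewrite -fsbig_distrr /=; last first.
    by apply: sub_finite_set (finite_parts2 d) => p /= [[_ e1] [_ e2]]; lia.
  congr (_ * _); rewrite /E_ fsbig_distrr /=; last exact: finite_evens.
  rewrite -(@fsum_dep _ _ _ (evens (d - a.*2))
    (fun ga => [set bt | hs bt ga /\ psize bt = (psize ga + a)%N])
    (fun ga bt => S_ N j bt)).
  - by apply: eq_fsbigr => ga _; rewrite pieri_S.
  - exact: finite_evens.
  - by apply: sub_finite_set (finite_parts2 d) => p /= [[_ e1] [_ e2]]; lia.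
symmetry.
apply: (@fsum_bij _ _ _ _ _ (fun p => (psize p.1 - psize p.2, (even_dn p.2, p.2))%N)
   (fun q => (even_up q.2.2, q.2.2))).
- move=> [be bt] /= [[ev e] h]; have ee := even_up_uniq ev h.
  have := psize_even bt; rewrite -ee e => s.
  have := hs_psize (hs_even_dn bt); have := hs_psize h => h1 h2.
  split; first by lia.
  by split; [split; [exact: even_part_dn|] | split; [exact: hs_even_dn|]]; lia.
- move=> [a [ga bt]] /= [ad [[ev e] [h e']]]; split; last exact: hs_even_up.
  split; first exact: even_part_up.
  by have := psize_even bt; rewrite -(even_dn_uniq ev h); lia.
- by move=> [be bt] /= [[ev e] h]; rewrite -(even_up_uniq ev h).
- move=> [a [ga bt]] /= [ad [[ev e] [h e']]].
  rewrite -(even_dn_uniq ev h); congr (_, _).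
  by have := psize_even bt; rewrite -(even_dn_uniq ev h); lia.
- by move=> [be bt].
Qed.

(** * Semistandard oscillating tableaux *)

Definition ssn (j : nat) (la : part) (d : nat) : set osc :=
  [set S : osc | [/\ S.1 0%N = empty_part /\ S.2 0%N = empty_part,
    forall i, hs (S.1 i) (S.2 i), forall i, hs (S.1 i.+1) (S.2 i),
    forall i, (j <= i)%N -> S.1 i = la /\ S.2 i = la &
    (\sum_(i < j) osc_mult S i = psize la + d)%N]].

Lemma finite_ssn j la d : finite_set (ssn j la d).
Proof.
have fF := finite_fun la j (finite_parts_le (psize la + d)).
apply: sub_finite_set (finite_setX fF fF) => -[S S'] [[S0 S'0] h h' e l] /=.
simpl in S0, S'0, h, h', e, l.
have b i : (i <= j)%N -> (psize (S i) <= \sum_(k < i) osc_mult (S, S') k)%N.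
  elim: i => [|i IHi] ij; first by rewrite S0.
  rewrite big_ord_recr /= {2}/osc_mult /skew_size /=.
  have := IHi (ltnW ij) => /=; have := hs_psize (h i).
  by have := hs_psize (h' i); lia.
have mono i : (i <= j)%N ->
    (\sum_(k < i) osc_mult (S, S') k <= \sum_(k < j) osc_mult (S, S') k)%N.
  move=> ij; rewrite (big_ord_widen j (osc_mult (S, S')) ij) big_mkcond /=.
  by apply: leq_sum => k _; case: ifP.
have bS i : (psize (S i) <= psize la + d)%N.
  case: (leqP i j) => ij; first by rewrite -l (leq_trans (b i ij) (mono i ij)).
  by have [-> _] := e i (ltnW ij); rewrite leq_addr.
split; split=> i; try by move=> /e [].
  exact: bS.
exact: leq_trans (hs_psize (h i)) (bS i).
Qed.

Definition Z_ (N j : nat) (la : part) (d : nat) : {mpoly rat[N]} :=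
  \sum_(S \in ssn j la d) xw N (osc_mult S).

Definition osc_cut (j : nat) (ka : part) (S : osc) : osc :=
  (glue j ka S.1, fun i => if (i < j)%N then S.2 i else ka).

Definition osc_ext (j : nat) (la rho : part) (S : osc) : osc :=
  (glue j la S.1,
   fun i => if (i < j)%N then S.2 i else if i == j then rho else la).

Definition ssn_steps (la : part) (d : nat) : set (part * part) :=
  [set q | hs la q.1 /\ (hs q.2 q.1 /\ ((psize q.2 - psize q.1).*2 <= d)%N)].

Lemma finite_ssn_steps la d : finite_set (ssn_steps la d).
Proof.
apply: sub_finite_set (finite_parts2 (psize la + d)) => q /= [/hs_psize h1 [_ h2]].
by lia.
Qed.

Lemma sum_osc_mult_eq j (S S' : osc) :
  (forall i, (i < j)%N -> osc_mult S i = osc_mult S' i) ->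
  (\sum_(i < j) osc_mult S i = \sum_(i < j) osc_mult S' i)%N.
Proof. by move=> e; apply: eq_bigr => i _; apply: e. Qed.

Lemma osc_mult_cut j ka (S : osc) i : S.1 j = ka -> (i < j)%N ->
  osc_mult (osc_cut j ka S) i = osc_mult S i.
Proof.
by move=> e ij; rewrite /osc_mult /osc_cut /glue /= (ltnW ij) ij.
Qed.

Lemma osc_mult_ext j la rho (S : osc) i : (i < j)%N ->
  osc_mult (osc_ext j la rho S) i = osc_mult S i.
Proof.
by move=> ij; rewrite /osc_mult /osc_ext /glue /= (ltnW ij) ij.
Qed.

Lemma osc_mult_ext_j j la rho (S : osc) :
  osc_mult (osc_ext j la rho S) j =
  (psize la - psize rho + (psize (S.1 j) - psize rho))%N.
Proof.
by rewrite /osc_mult /osc_ext /glue /= leqnn ltnn eqxx /skew_size addnC.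
Qed.

Lemma osc_extK j la (rho ka : part) d (S : osc) : ssn j ka d S ->
  osc_cut j ka (osc_ext j la rho S) = S.
Proof.
case: S => S S' [_ _ _ l _]; rewrite /osc_cut /osc_ext /glue /=.
congr (_, _); apply/funext => i.
  by case: (leqP i j) => // /ltnW /l /= [->].
by case: (ltnP i j) => // /l /= [_ ->].
Qed.

Lemma osc_cutK j la ka d (S : osc) : ssn j.+1 la d S ->
  osc_ext j la (S.2 j) (osc_cut j ka S) = S.
Proof.
case: S => S S' [_ _ _ l _]; rewrite /osc_cut /osc_ext /glue /=.
congr (_, _); apply/funext => i.
  by case: (leqP i j) => // /l /= [->].
by case: (ltngtP i j) => [ij|/l /= [_ ->]|->].
Qed.

Lemma ssn_ext j la rho ka d (S : osc) : ssn_steps la d (rho, ka) ->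
  ssn j ka (d - (psize ka - psize rho).*2) S -> ssn j.+1 la d (osc_ext j la rho S).
Proof.
case: S => S S' /= [lr [kr le]] [[S0 S'0] h h' l e].
have [Sj S'j] := l j (leqnn j); simpl in *.
split; rewrite /osc_ext /glue /=.
- split=> //; case: (ltnP 0 j) => // j0; have j00 : j = 0%N by lia.
  rewrite ifT ?j00 //; apply: psize_eq0; apply/eqP; rewrite -leqn0.
  by rewrite -psize_empty -S0 -{1}j00 Sj; apply: hs_psize.
- move=> i; case: (ltngtP i j) => [ij|ij|->]; [exact: h | exact: hs_refl|].
  by rewrite Sj.
- by move=> i; case: (ltngtP i j) => [ij|ij|_] //; apply: hs_refl.
- by move=> i ji; rewrite leqNgt ji /= ifN ?ifN //; lia.
rewrite big_ord_recr /= -/(glue j la S).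
rewrite (sum_osc_mult_eq (S' := (S, S'))) => [|i ij]; last first.
  exact: (@osc_mult_ext j la rho (S, S')).
rewrite (@osc_mult_ext_j j la rho (S, S')) /= Sj e.
have := hs_psize lr; have := hs_psize kr; lia.
Qed.

Lemma ssn_cut j la d (S : osc) : ssn j.+1 la d S ->
  ssn_steps la d (S.2 j, S.1 j) /\
  ssn j (S.1 j) (d - (psize (S.1 j) - psize (S.2 j)).*2) (osc_cut j (S.1 j) S).
Proof.
move=> SP; have fS := finite_ssn j.+1 la d; case: (SP) => -[S0 S'0] h h' l e.
have lj : hs la (S.2 j) by have := h' j; have [-> _] := l j.+1 (leqnn _).
have e' : (\sum_(i < j) osc_mult (osc_cut j (S.1 j) S) i +
    (psize (S.1 j) - psize (S.2 j)).*2 = psize (S.1 j) + d)%N.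
  rewrite (sum_osc_mult_eq (S' := S)) => [|i ij]; last exact: osc_mult_cut.
  move: e; rewrite big_ord_recr /= {2}/osc_mult /skew_size.
  have [-> _] := l j.+1 (leqnn _).
  have := hs_psize lj; have := hs_psize (h j); lia.
have b i : (i <= j)%N -> (psize (S.1 i) <= \sum_(k < i) osc_mult (osc_cut j (S.1 j) S) k)%N.
  elim: i => [|i IHi] ij; first by rewrite S0.
  rewrite big_ord_recr /= osc_mult_cut // {2}/osc_mult /skew_size /=.
  have := IHi (ltnW ij) => /=; have := hs_psize (h i).
  by have := hs_psize (h' i); lia.
have bj := b j (leqnn j).
split; first by do 2!split=> //=; lia.
split; [| | | |lia]; rewrite /osc_cut /glue /=.
- by split=> //; case: (posnP j) => // ->.
- by move=> i; case: (ltngtP i j) => [ij|ij|->] //; apply: hs_refl.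
- move=> i; case: (ltnP i j) => ij //; exact: hs_refl.
- move=> i ji; rewrite ltnNge ji /=; split=> //.
  by case: (ltngtP i j) ji => // ->.
Qed.

Lemma Z_branch N j la d : Z_ N j.+1 la d =
  \sum_(q \in ssn_steps la d)
    xv N j (psize la - psize q.1 + (psize q.2 - psize q.1)) *
    Z_ N j q.2 (d - (psize q.2 - psize q.1).*2).
Proof.
rewrite /Z_ (@fsum_fibers _ _ _ _ (ssn_steps la d) (fun S => (S.2 j, S.1 j))).
- apply: eq_fsbigr => -[rho ka]; rewrite inE => st /=.
  rewrite fsbig_distrr /=; last exact: finite_ssn.
  apply: (@fsum_bij _ _ _ _ _ (osc_ext j la rho) (osc_cut j ka)).
  + move=> S SP /=; split; first exact: ssn_ext st SP.
    rewrite /osc_ext /glue /= leqnn ltnn eqxx; congr (_, _).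
    by case: SP => _ _ _ /(_ j (leqnn j)) [].
  + by move=> S /= [SP [<- <-]]; case: (ssn_cut SP).
  + by move=> S SP; apply: osc_extK SP.
  + by move=> S /= [SP [<- <-]]; apply: osc_cutK SP.
  + move=> S SP; rewrite /xv -xwD; apply: eq_xw => i _.
    case: (SP) => _ _ _ l _; have [Sj S'j] := l j (leqnn j).
    case: (ltngtP i j) => [ij|ij|->].
    * by rewrite osc_mult_ext // mul0n.
    * rewrite mul0n /osc_mult /osc_ext /glue /= /skew_size.
      have [-> ->] := l i (ltnW ij); have [-> _] := l i.+1 (leqW (ltnW ij)).
      by rewrite !ifN ?subnn //; lia.
    * rewrite mul1n osc_mult_ext_j Sj /osc_mult /skew_size Sj S'j.
      by have [-> _] := l j.+1 (leqnSn j); rewrite !subnn !addn0.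
- exact: finite_ssn.
- exact: finite_ssn_steps.
- by move=> S /ssn_cut [].
Qed.

Lemma Z_0 N la d : Z_ N 0 la d = ((la == empty_part) && (d == 0%N))%:R.
Proof.
rewrite /Z_; case: eqP => [->|la0] /=; last first.
  rewrite (_ : ssn 0 la d = set0) ?fsbig_set0 //; apply/seteqP; split=> // S.
  by case=> -[S0 _] _ _ /(_ 0%N (leqnn 0)) [e _] _; case: la0; rewrite -e.
case: eqP => [->|d0] /=; last first.
  rewrite (_ : ssn 0 empty_part d = set0) ?fsbig_set0 //.
  by apply/seteqP; split=> // S [_ _ _ _]; rewrite big_ord0 => /esym.
rewrite (_ : ssn 0 empty_part 0 = [set (fun=> empty_part, fun=> empty_part)]).
  by rewrite fsbig_set1 /xw -[RHS]mpolyX0; congr 'X_[_]; apply/mnmP => i;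
    rewrite mnmE mnm0E.
apply/seteqP; split=> [[S S'] [_ _ _ l _]|_ ->] /=.
  by congr (_, _); apply/funext => i; have [] := l i (leq0n i).
split; rewrite ?big_ord0 //=; by move=> i; apply: hs_refl.
Qed.

Lemma Z_eq N j la d : Z_ N j la d = S_ N j la * E_ N j d.
Proof.
elim: j la d => [|j IHj] la d.
  rewrite Z_0 S_0; case: eqP => [_|_]; last by rewrite mul0r.
  rewrite mul1r /E_ /=; case: eqP => [->|d0].
    rewrite (_ : evens 0 = [set empty_part]) ?fsbig_set1 ?S_0 ?eqxx //.
    apply/seteqP; split=> [be [_ /psize_eq0] //|_ ->] /=.
    by split=> // k; rewrite !row0.
  rewrite fsbig1 // => be [_ e]; rewrite S_0; case: eqP => // be0.
  by case: d0; rewrite -e be0.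
rewrite S_branch E_branch; have fd := finite_hs_down la; have f2 := finite_double d.
rewrite fsbig_finite // mulr_suml -fsbig_finite //.
transitivity (\sum_(rho \in [set rho | hs la rho])
  \sum_(ka \in [set ka | hs ka rho /\ ((psize ka - psize rho).*2 <= d)%N])
    xv N j (psize la - psize rho + (psize ka - psize rho)) *
    Z_ N j ka (d - (psize ka - psize rho).*2)).
  rewrite Z_branch -(@fsum_dep _ _ _ [set rho | hs la rho]
   (fun rho => [set ka | hs ka rho /\ ((psize ka - psize rho).*2 <= d)%N])
   (fun rho ka => xv N j (psize la - psize rho + (psize ka - psize rho)) *
    Z_ N j ka (d - (psize ka - psize rho).*2))) //.
  exact: finite_ssn_steps.
apply: eq_fsbigr => rho; rewrite inE /= => lr.
rewrite (@fsum_fibers _ _ _ _ [set a | (a.*2 <= d)%N] (fun ka => psize ka - psize rho)%N) //.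
- rewrite fsbig_distrr //; apply: eq_fsbigr => a; rewrite inE /= => ad.
  rewrite mulrACA -xvD (mulrA (S_ N j rho)) (mulrC (S_ N j rho)) pieri_S.
  have fu := finite_hs_up rho a.
  rewrite [in RHS]fsbig_finite // mulr_suml mulr_sumr -fsbig_finite //.
  rewrite (_ : [set x | _] = [set ka | hs ka rho /\ psize ka = (psize rho + a)%N]).
    apply: eq_fsbigr => ka; rewrite inE /= => -[/hs_psize h e].
    by rewrite IHj e addKn.
  apply/seteqP; split=> ka /=; first by move=> [[h _] <-]; split=> //; have := hs_psize h; lia.
  by move=> [h e]; split; [split=> //|]; lia.
- apply: sub_finite_set (finite_parts_le (psize la + d)) => ka /= [_ h].
  by have := hs_psize lr; lia.
- by move=> ka [].
Qed.

Lemma mcoeff_sum_xw (T : choiceType) N (A : set T) (f : T -> nat -> nat) a :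
  finite_set A ->
  (\sum_(x \in A) xw N (f x))@_(mon N a) =
  #|` fset_set [set x | A x /\ forall i, (i < N)%N -> f x i = a i]|%:R.
Proof.
move=> fA; rewrite card_fset_setE; last first.
  by apply: sub_finite_set fA => x [].
rewrite fsbig_finite // raddf_sum /= -fsbig_finite //.
rewrite (_ : [set x | _] = A `&` [set x | forall i, (i < N)%N -> f x i = a i]) //.
rewrite fsbig_mkcondr; apply: eq_fsbigr => x _; rewrite mcoeffX.
have -> : (x \in [set x | forall i, (i < N)%N -> f x i = a i]) = (mon N (f x) == mon N a).
  apply/idP/eqP => [|/mnmP e]; rewrite inE /=.
    by move=> e; apply/mnmP => i; rewrite !mnmE e ?ltn_ord.
  by move=> i iN; have := e (Ordinal iN); rewrite !mnmE.
by case: eqP.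
Qed.

Lemma osc_length_sum N (S : osc) : (forall i, (N <= i)%N -> osc_mult S i = 0%N) ->
  osc_length S = (\sum_(i < N) osc_mult S i)%N.
Proof.
move=> S0; rewrite /osc_length fsbig_ord; apply/esym; apply: fsbig_widen => //.
by move=> i [_ /= /negP]; rewrite -leqNgt => /S0.
Qed.

Lemma ss_coef N la d (a : monom) : (forall i, (N <= i)%N -> a i = 0%N) ->
  ss la (psize la + d) a = (Z_ N N la d)@_(mon N a).
Proof.
move=> a0; rewrite /Z_ mcoeff_sum_xw; last exact: finite_ssn.
rewrite /ss; congr ((#|` fset_set _|)%:R); apply/seteqP; split=> S /=.
  move=> [[[S0 S'0] h h' [i0 l]] e m].
  have m0 i : (N <= i)%N -> osc_mult S i = 0%N by move=> Ni; rewrite m a0.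
  have step i : (N <= i)%N -> S.1 i = S.2 i /\ S.1 i.+1 = S.2 i.
    move=> /m0; have hi := (hstripP _ _).1 (h i).
    have hi' := (hstripP _ _).1 (h' i); rewrite /osc_mult /skew_size => e0.
    by split; [apply: (hs_psize_eq hi) | apply: (hs_psize_eq hi')];
      have := hs_psize hi; have := hs_psize hi'; lia.
  have cst i k : (N <= i)%N -> S.1 (i + k)%N = S.1 i.
    move=> Ni; elim: k => [|k IHk]; first by rewrite addn0.
    have [e1 e2] := step (i + k)%N (leq_trans Ni (leq_addr _ _)).
    by rewrite addnS e2 -e1.
  have lN i : (N <= i)%N -> S.1 i = la.
    by move=> Ni; rewrite -(cst i i0 Ni); have [] := l (i + i0)%N (leq_addl _ _).
  split=> //; split=> //.
  - by move=> i; apply/hstripP.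
  - by move=> i; apply/hstripP.
  - by move=> i Ni; have [e1 _] := step i Ni; rewrite -e1 !lN.
  - by rewrite -(osc_length_sum m0).
move=> [[[S0 S'0] h h' l e] m].
have m0 i : (N <= i)%N -> osc_mult S i = 0%N.
  move=> Ni; rewrite /osc_mult /skew_size; have [-> ->] := l i Ni.
  by have [-> _] := l i.+1 (leqW Ni); rewrite !subnn.
split; last by move=> i; case: (ltnP i N) => [/m //|Ni]; rewrite m0 // a0.
  split=> //; [by move=> i; apply/hstripP | by move=> i; apply/hstripP |].
  by exists N.
by rewrite (osc_length_sum m0).
Qed.

(** * Tableaux as chains of partitions *)

Lemma ltn_count_sorted (r : seq nat) i j : sorted leq r ->
  (j < count (fun x => x < i)%N r)%N = (j < size r)%N && (nth 0%N r j < i)%N.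
Proof.
elim: r j => [|x r IHr] //= j sr; have s' := path_sorted sr.
case: (ltnP x i) => xi /=.
  by case: j => [|j] /=; rewrite ?xi // add1n ltnS IHr.
have -> : count (fun y => y < i)%N r = 0%N.
  apply/eqP; rewrite -leqn0 leqNgt -has_count; apply/hasPn => y yr.
  rewrite -leqNgt; apply: leq_trans xi _.
  by have /allP/(_ y yr) := order_path_min leq_trans sr.
rewrite ltn0; case: j => [|j] /=; first by rewrite ltnNge xi.
rewrite ltnS; case: (ltnP j (size r)) => //= jr.
have /allP/(_ _ (mem_nth 0%N jr)) := order_path_min leq_trans sr.
by move=> /(leq_trans xi); rewrite ltnNge => ->.
Qed.

Lemma sorted_eq_count (r s : seq nat) : sorted leq r -> sorted leq s ->
  size r = size s ->
  (forall i, count (fun x => x < i)%N r = count (fun x => x < i)%N s) -> r = s.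
Proof.
move=> sr ss e c; apply: (eq_from_nth (x0 := 0%N) e) => j jr.
have lt i : (nth 0 r j < i)%N = (nth 0 s j < i)%N.
  have := ltn_count_sorted i j sr; rewrite c ltn_count_sorted // jr -e jr /=.
  by move=> ->.
by apply/eqP; rewrite eqn_leq leqNgt -lt ltnn leqNgt lt ltnn.
Qed.

Definition chain_of_tab (T : seq (seq nat)) (i : nat) : part :=
  ofrow (fun k => count (fun x => x < i)%N (nth [::] T k)).

Definition tab_entry (N : nat) (g : nat -> part) (k j : nat) : nat :=
  find (fun i => j < row (g i.+1) k)%N (iota 0 N).

Definition tab_of_chain (N : nat) (la : part) (g : nat -> part) : seq (seq nat) :=
  mkseq (fun k => mkseq (tab_entry N g k) (row la k)) (size la).

Section TabOfChain.
Variables (N : nat) (la : part) (g : nat -> part).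
Hypothesis gP : gt N la g.

Lemma gt_row_mono k i j : (i <= j)%N -> (row (g i) k <= row (g j) k)%N.
Proof.
have [_ gh _] := gP.
apply: (@homo_leq _ (fun i => row (g i) k) leq leqnn leq_trans) => i'.
by case: (gh i' k).
Qed.

Lemma gt_row_le k i : (row (g i) k <= row la k)%N.
Proof.
have [_ _ gl] := gP.
by rewrite -(gl (N + i)%N) ?leq_addr //; apply: gt_row_mono; rewrite leq_addl.
Qed.

Lemma ltn_tab_entry k i j : (j < row la k)%N ->
  (tab_entry N g k j < i)%N = (j < row (g i) k)%N.
Proof.
have [g0 gh gl] := gP; move=> jl; rewrite /tab_entry; set p := (X in find X _).
apply/idP/idP => [lt|jg].
  have [hp|hp] := boolP (has p (iota 0 N)).
    have := nth_find 0%N hp; rewrite nth_iota; last first.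
      by rewrite -[X in (_ < X)%N](size_iota 0) -has_find.
    by rewrite /p add0n => /leq_trans; apply; apply: gt_row_mono.
  move: lt; rewrite hasNfind // size_iota => Ni.
  by rewrite gl // ltnW.
case: i jg => [|i] jg; first by rewrite g0 row0 in jg.
rewrite ltnS leqNgt; apply/negP => lt; have := before_find 0%N lt.
have iN : (i < N)%N.
  by apply: leq_trans lt _; rewrite -[X in (_ <= X)%N](size_iota 0) find_size.
by rewrite nth_iota // add0n /p jg.
Qed.

Lemma nth_tab_of_chain k :
  nth [::] (tab_of_chain N la g) k = mkseq (tab_entry N g k) (row la k).
Proof.
case: (ltnP k (size la)) => kl; first by rewrite nth_mkseq.
rewrite nth_default ?size_mkseq // (_ : row la k = 0%N) //.
exact: row_eq0 (row_size la) kl.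
Qed.

Lemma count_ltn_iota m n : (m <= n)%N ->
  count (fun x => x < m)%N (iota 0 n) = m.
Proof.
move=> /subnKC <-; rewrite iotaD count_cat.
rewrite (_ : count _ (iota 0 m) = size (iota 0 m)); last first.
  by apply/eqP; rewrite -all_count; apply/allP => x; rewrite mem_iota.
rewrite size_iota (_ : count _ _ = 0%N) ?addn0 //.
apply/eqP; rewrite -leqn0 leqNgt -has_count; apply/hasPn => x.
by rewrite mem_iota add0n -leqNgt => /andP[].
Qed.

Lemma count_tab_row k i :
  count (fun x => x < i)%N (mkseq (tab_entry N g k) (row la k)) = row (g i) k.
Proof.
rewrite count_map -[RHS](count_ltn_iota (gt_row_le k i)).
by apply: eq_in_count => j; rewrite mem_iota /= => jl; rewrite ltn_tab_entry.
Qed.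

Lemma sorted_tab_row k : sorted leq (mkseq (tab_entry N g k) (row la k)).
Proof.
rewrite sorted_map; apply: (@sub_in_sorted _ [pred j | (j < row la k)%N] leq).
- move=> i j ik jk ij; rewrite /relpre /=; rewrite leqNgt.
  rewrite !inE in ik jk; apply/negP => /[dup].
  rewrite {1}ltn_tab_entry // => lt; apply/negP; rewrite -leqNgt.
  by rewrite -ltnS ltn_tab_entry // (leq_ltn_trans ij) // -ltn_tab_entry.
- by apply/allP => x; rewrite mem_iota.
- exact: iota_sorted.
Qed.

Lemma is_ssyt_tab_of_chain : is_ssyt la (tab_of_chain N la g).
Proof.
have [g0 gh gl] := gP; split.
- apply: (@eq_from_nth _ 0%N); rewrite size_map size_mkseq // => k kl.
  by rewrite (nth_map [::]) ?size_mkseq // nth_tab_of_chain size_mkseq.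
- by apply/allP => r /mapP[k _ ->]; apply: sorted_tab_row.
move=> k j; rewrite /in_diagram -/(row _ _) => jl.
have jl' : (j < row la k)%N by apply: leq_trans jl (row_noninc _ _).
rewrite !nth_tab_of_chain !nth_mkseq // ltn_tab_entry //.
have : (j < row (g (tab_entry N g k.+1 j).+1) k.+1)%N by rewrite -ltn_tab_entry.
by move=> /leq_trans; apply; case: (gh (tab_entry N g k.+1 j) k).
Qed.

Lemma tab_of_chainK : chain_of_tab (tab_of_chain N la g) = g.
Proof.
apply/funext => i; apply: part_ext => k.
have e l : count (fun x => x < i)%N (nth [::] (tab_of_chain N la g) l) = row (g i) l.
  by rewrite nth_tab_of_chain count_tab_row.
rewrite /chain_of_tab (@row_ofrow _ (size (g i))) // => {}k; rewrite ?e.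
  exact: row_noninc.
exact: row_eq0 (row_size _).
Qed.

End TabOfChain.

Section ChainOfTab.
Variables (la : part) (T : seq (seq nat)).
Hypothesis TP : is_ssyt la T.

Let cnt_lt i k := count (fun x => x < i)%N (nth [::] T k).

Lemma size_tab : size T = size la.
Proof. by have [<- _ _] := TP; rewrite size_map. Qed.

Lemma size_tab_row k : size (nth [::] T k) = row la k.
Proof.
have [e _ _] := TP; rewrite /row -e.
case: (ltnP k (size T)) => kT; first by rewrite (nth_map [::]).
by rewrite !nth_default ?size_map.
Qed.

Lemma sorted_tab k : sorted leq (nth [::] T k).
Proof.
have [_ /allP s _] := TP; case: (ltnP k (size T)) => kT; last by rewrite nth_default.
by apply: s; apply: mem_nth.
Qed.

Lemma tab_strict k i : (cnt_lt i.+1 k.+1 <= cnt_lt i k)%N.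
Proof.
have [_ _ c] := TP; rewrite leqNgt; apply/negP.
rewrite ltn_count_sorted; last exact: sorted_tab.
rewrite size_tab_row => /andP[jl]; have := c _ _ jl => lt lt'.
have : (cnt_lt i k < cnt_lt i k)%N; last by rewrite ltnn.
rewrite {2}/cnt_lt ltn_count_sorted; last exact: sorted_tab.
rewrite size_tab_row (leq_trans jl (row_noninc _ _)) //=.
exact: leq_trans lt lt'.
Qed.

Lemma tab_count_mono i k : (cnt_lt i k <= cnt_lt i.+1 k)%N.
Proof. by apply: sub_count => x /= /ltnW. Qed.

Lemma row_chain_of_tab i k : row (chain_of_tab T i) k = cnt_lt i k.
Proof.
apply: (@row_ofrow _ (size T)) => {}k.
  exact: leq_trans (tab_count_mono _ _) (tab_strict _ _).
by move=> kT; rewrite nth_default.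
Qed.

Lemma wt_chain_of_tab i : wt (chain_of_tab T) i = count_mem i (flatten T).
Proof.
have z j : row (chain_of_tab T j) (size T) = 0%N.
  by rewrite row_chain_of_tab /cnt_lt nth_default.
rewrite /wt !(psizeE (z _)) count_flatten sumnE big_map (big_nth [::]) big_mkord.
rewrite -sumnB => [|k _]; last by rewrite !row_chain_of_tab tab_count_mono.
apply: eq_bigr => k _; rewrite !row_chain_of_tab /cnt_lt.
elim: (nth _ T k) => //= x r <-.
have := @sub_count _ (fun x => x < i)%N (fun x => x < i.+1)%N (fun x => @ltnW x.+1 i.+1) r.
by case: (ltngtP x i) => xi /=; rewrite ?ltnS; lia.
Qed.

Lemma gt_chain_of_tab N : (forall k, (N <= k)%N -> count_mem k (flatten T) = 0%N) ->
  gt N la (chain_of_tab T).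
Proof.
move=> c0; split=> [|i k|i Ni].
- apply: part_ext => k; rewrite row_chain_of_tab row0 /cnt_lt.
  by elim: (nth _ T k).
- by rewrite !row_chain_of_tab tab_count_mono tab_strict.
apply: part_ext => k; rewrite row_chain_of_tab /cnt_lt -size_tab_row.
apply/eqP; rewrite -all_count; apply/allP => x xT; rewrite ltnNge; apply/negP => ix.
have := c0 x (leq_trans Ni ix); apply/eqP; rewrite -lt0n -has_count has_pred1.
apply/flattenP; exists (nth [::] T k) => //; apply: mem_nth.
by rewrite ltnNge; apply/negP => kT; rewrite nth_default in xT.
Qed.

Lemma chain_of_tabK N : gt N la (chain_of_tab T) ->
  tab_of_chain N la (chain_of_tab T) = T.
Proof.
move=> gP; apply: (@eq_from_nth _ [::]); first by rewrite size_mkseq size_tab.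
move=> k _; rewrite nth_tab_of_chain; apply: sorted_eq_count.
- exact: sorted_tab_row gP k.
- exact: sorted_tab.
- by rewrite size_mkseq size_tab_row.
by move=> i; rewrite (count_tab_row gP) row_chain_of_tab.
Qed.

End ChainOfTab.

Lemma schur_coef N la (a : monom) : (forall i, (N <= i)%N -> a i = 0%N) ->
  schur la a = (S_ N N la)@_(mon N a).
Proof.
move=> a0; rewrite /S_ mcoeff_sum_xw; last exact: finite_gt.
rewrite /schur; congr (_%:R); symmetry.
apply: (@card_fset_set_bij _ _ _ _ (tab_of_chain N la) chain_of_tab) => /=.
- by apply: sub_finite_set (finite_gt N la) => g [].
- move=> g [gP e]; have sP := is_ssyt_tab_of_chain gP; split=> // i.
  rewrite -(wt_chain_of_tab sP) (tab_of_chainK gP).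
  by case: (ltnP i N) => [/e //|Ni]; rewrite a0 // (wt_ge gP).
- move=> T [TP e]; split; last by move=> i _; rewrite (wt_chain_of_tab TP).
  by apply: gt_chain_of_tab => // k Nk; rewrite e a0.
- by move=> g [gP _]; apply: tab_of_chainK gP.
- move=> T [TP e]; apply: chain_of_tabK => //.
  by apply: gt_chain_of_tab => // k Nk; rewrite e a0.
Qed.

(** * Schur coordinates *)

(* The coordinate on [nu] of [ss la (psize la + d)] is the number of these
   pairs: since [Z_ N N la d] is the sum of the products [S_ be * S_ la] for
   even [be], the rule [S_mul] lets [be] be the dominant weight and [la] the
   shape of the tableaux. *)
Definition lrset (la : part) (d : nat) (nu : part) : set (part * (nat -> part)) :=
  [set p | [/\ evens d p.1, gt (psize nu) la p.2, dom p.1 p.2 &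
               forall k, row nu k = (row p.1 k + wt p.2 k)%N]].

Lemma gt_widen N N' la g : (N <= N')%N -> gt N la g -> gt N' la g.
Proof. by move=> NN [g0 gh gl]; split=> // i Ni; apply: gl; apply: leq_trans Ni. Qed.

Lemma finite_lrset la d nu : finite_set (lrset la d nu).
Proof.
apply: sub_finite_set (finite_setX (finite_evens d) (finite_gt (psize nu) la)).
by move=> p [].
Qed.

Lemma gt_support N N' la g : gt N la g ->
  (forall i, (N' <= i)%N -> wt g i = 0%N) -> gt N' la g.
Proof.
move=> [g0 gh gl] w0; split=> // i N'i; rewrite -(gl (i + N)%N) ?leq_addl //.
elim: {gl} N => [|N IHN]; first by rewrite addn0.
rewrite addnS IHN; apply/esym/hs_psize_eq => //.
have := w0 (i + N)%N (leq_trans N'i (leq_addr _ _)); rewrite /wt.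
by have := hs_psize (gh (i + N)%N); lia.
Qed.

Lemma sum_wt N la g : gt N la g -> (\sum_(i < N) wt g i = psize la)%N.
Proof.
move=> [g0 gh gl]; rewrite -(gl N) //; elim: {gl} N => [|N IHN].
  by rewrite big_ord0 g0.
by rewrite big_ord_recr /= IHN /wt subnKC // hs_psize.
Qed.

Lemma psize_add_wt N be la g nu : row be N = 0%N -> gt N la g ->
  (forall k, row nu k = row be k + wt g k)%N -> psize nu = (psize be + psize la)%N.
Proof.
move=> beN gP e; have nuN : row nu N = 0%N by rewrite e beN (wt_ge gP).
rewrite (psizeE nuN) (psizeE beN) -(sum_wt gP) -big_split /=.
by apply: eq_bigr => k _; rewrite e.
Qed.

Lemma Z_schur N la d : (psize la + d <= N)%N ->
  Z_ N N la d =
  \sum_(nu \in parts (psize la + d)) #|` fset_set (lrset la d nu)|%:R *: S_ N N nu.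
Proof.
move=> nN; have fe := finite_evens d; have fg := finite_gt N la.
have beN be : evens d be -> row be N = 0%N.
  by move=> [_ e]; apply: row_psize; lia.
rewrite Z_eq /E_ fsbig_distrr //=.
pose A := [set p : part * (nat -> part) | evens d p.1 /\ (gt N la p.2 /\ dom p.1 p.2)].
have fA : finite_set A.
  by apply: sub_finite_set (finite_setX fe fg) => p [h1 [h2 _]].
transitivity (\sum_(p \in A) S_ N N (addw p.1 p.2)).
  rewrite /A -(@fsum_dep _ _ _ (evens d) (fun be => [set g | gt N la g /\ dom be g])
    (fun be g => S_ N N (addw be g))) //.
  by apply: eq_fsbigr => be; rewrite inE => /beN bN; rewrite mulrC S_mul.
have rE p k : A p -> row (addw p.1 p.2) k = (row p.1 k + wt p.2 k)%N.
  by move=> [h1 [h2 h3]]; apply: row_addw (beN _ h1) h2 h3.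
have szE p : A p -> psize (addw p.1 p.2) = (psize la + d)%N.
  move=> Ap; have [h1 [h2 h3]] := Ap.
  rewrite (psize_add_wt (beN _ h1) h2 (fun k => rE p k Ap)) addnC.
  by case: h1 => _ ->.
rewrite (@fsum_fibers _ _ _ _ (parts (psize la + d)) (fun p => addw p.1 p.2)) //;
  last exact: finite_parts.
apply: eq_fsbigr => nu; rewrite inE => nuP.
have -> : [set p | A p /\ addw p.1 p.2 = nu] = lrset la d nu.
  apply/seteqP; split=> p /=.
    move=> [Ap e]; have [h1 [h2 h3]] := Ap; split=> //; last by move=> k; rewrite -e rE.
    apply: (gt_support h2) => i ni; have := rE p i Ap.
    by rewrite e (row_psize ni); lia.
  move=> [h1 h2 h3 e]; have h2' : gt N la p.2.
    by apply: gt_widen h2; rewrite nuP.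
  have Ap : A p by [].
  by split=> //; apply: part_ext => k; rewrite rE // e.
rewrite (eq_fsbigr (fun=> 1 *: S_ N N nu)) => [|p]; last first.
  rewrite inE scale1r => -[h1 h2 h3 e]; congr S_; apply: part_ext => k.
  rewrite (rE p) ?e //; split=> //; split=> //.
  by apply: gt_widen h2; rewrite nuP.
rewrite card_fset_setE; last exact: finite_lrset.
rewrite !fsbig_finite; try exact: finite_lrset.
by rewrite scaler_suml.
Qed.

Lemma monom_bound (a : monom) : exists N, forall i, (N <= i)%N -> a i = 0%N.
Proof.
exists (\max_(i <- finsupp a) i).+1 => i; rewrite ltnNge => le.
apply: fsfun_dflt; apply: contra le => ia.
by rewrite (big_rem i ia) /= leq_maxl.
Qed.

Lemma mon_monom N (m : 'X_{1..N}) :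
  exists a : monom, (forall i, (N <= i)%N -> a i = 0%N) /\ mon N a = m.
Proof.
pose f i : nat := if insub i is Some j then m j else 0%N.
exists [fsfun i in [fset i | i in iota 0 N]%fset => f i | 0%N]; split=> [i Ni|].
  rewrite fsfunE; case: ifP => // _; rewrite /f insubN // -leqNgt //.
apply/mnmP => i; rewrite mnmE fsfunE; case: ifP => [_|/negP[]].
  by rewrite /f valK.
by apply/imfsetP; exists (val i) => //; rewrite mem_iota add0n ltn_ord.
Qed.

Lemma schur_coordE la d nu : parts (psize la + d) nu ->
  schur_coord (psize la + d) (ss la (psize la + d)) nu =
  #|` fset_set (lrset la d nu)|%:R.
Proof.
move=> nuP; set n := (psize la + d)%N in nuP *; have fp := finite_parts n.
pose c (nu : part) : rat := #|` fset_set (lrset la d nu)|%:R.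
pose P := [set c | forall a, ss la n a = \sum_(nu \in parts n) c nu * schur nu a].
have Pc : P c.
  move=> a; have [N0 a0] := monom_bound a; pose N := maxn n N0.
  have a0' i : (N <= i)%N -> a i = 0%N.
    by move=> Ni; apply: a0; apply: leq_trans Ni; apply: leq_maxr.
  rewrite (ss_coef la d a0') Z_schur ?leq_maxl // !fsbig_finite // raddf_sum /=.
  by apply: eq_bigr => ka _; rewrite mcoeffZ (schur_coef _ a0').
have Puniq c' : P c' -> c' nu = c nu.
  move=> Pc'; pose p := \sum_(ka \in parts n) (c' ka - c ka) *: S_ n n ka.
  have p0 : p = 0.
    apply/mpolyP => m; have [a [a0 <-]] := mon_monom m.
    rewrite mcoeff0 /p fsbig_finite // raddf_sum /=.
    transitivity (\sum_(ka <- fset_set (parts n)) (c' ka * schur ka a - c ka * schur ka a)).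
      by apply: eq_bigr => ka _; rewrite mcoeffZ mulrBl (schur_coef _ a0).
    by rewrite sumrB -!fsbig_finite // -Pc -Pc' subrr.
  have rn ka : parts n ka -> row ka n = 0%N by move=> e; apply: row_psize; rewrite e.
  have : coord nu p = c' nu - c nu.
    rewrite /coord /p fsbig_finite // mulr_sumr raddf_sum /= -fsbig_finite //.
    rewrite (fsbigD1 nu) //= fsbig1 ?addr0 => [|ka [kaP /= ne]].
      by rewrite -scalerAr mcoeffZ -/(coord _ _) coord_S ?rn // eqxx mulr1.
    rewrite -scalerAr mcoeffZ -/(coord _ _) coord_S ?rn // (_ : nu == ka = false) ?mulr0 //.
    by apply/eqP => e; apply: ne.
  by rewrite p0 /coord mulr0 mcoeff0 => /esym/eqP; rewrite subr_eq0 => /eqP.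
by apply: Puniq; apply: (@xgetI _ (fun=> 0) P c).
Qed.

Lemma hallE la mu d : psize la = psize mu ->
  hall (psize la + d) (ss la (psize la + d)) (ss mu (psize la + d)) =
  \sum_(nu \in parts (psize la + d))
    (#|` fset_set (lrset la d nu)|%:R * #|` fset_set (lrset mu d nu)|%:R : rat).
Proof.
move=> e; apply: eq_fsbigr => nu; rewrite inE => nuP.
by rewrite schur_coordE // e schur_coordE // -e.
Qed.

Lemma hall_ge0 la mu d : psize la = psize mu ->
  0 <= hall (psize la + d) (ss la (psize la + d)) (ss mu (psize la + d)).
Proof.
move=> e; rewrite hallE // fsbig_finite; last exact: finite_parts.
by apply: sumr_ge0 => nu _; rewrite mulr_ge0 ?ler0n.
Qed.

Lemma hall_gt0 la mu d : psize la = psize mu ->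
  (0 < hall (psize la + d) (ss la (psize la + d)) (ss mu (psize la + d))) <->
  exists nu p q, lrset la d nu p /\ lrset mu d nu q.
Proof.
move=> e; have fp := finite_parts (psize la + d).
have card_gt0 ka nu : (0 < #|` fset_set (lrset ka d nu)|)%N <-> exists p, lrset ka d nu p.
  have fl := finite_lrset ka d nu.
  rewrite cardfs_gt0; split=> [/fset0Pn[p]|[p pl]]; last apply/fset0Pn; last exists p.
    by rewrite in_fset_set // inE; exists p.
  by rewrite in_fset_set // inE.
split=> [|[nu [p [q [lp lq]]]]].
  rewrite hallE // fsbig_finite // lt_def => /andP[ne _].
  have [nu _ nu0] : exists2 nu, nu \in fset_set (parts (psize la + d)) &
     #|` fset_set (lrset la d nu)|%:R * #|` fset_set (lrset mu d nu)|%:R != 0 :> rat.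
    apply/hasP; apply: contraNT ne => /hasPn h; rewrite big1_seq // => nu /andP[_ nuP].
    by apply/eqP; have := h nu nuP; rewrite negbK.
  move: nu0; rewrite mulf_eq0 !pnatr_eq0 negb_or -!lt0n => /andP[].
  by move=> /card_gt0[p lp] /card_gt0[q lq]; exists nu, p, q.
have nuP : parts (psize la + d) nu.
  have [[_ bd] gP _ rE] := lp; rewrite /parts /= -bd addnC.
  apply: (psize_add_wt _ (gt_widen (leq_addr (psize p.1) _) gP) rE).
  by apply: row_psize; apply: leq_addl.
rewrite hallE // (fsbigD1 nu) //= ltr_wpDr //.
  rewrite fsbig_finite; last exact: finite_setD.
  by apply: sumr_ge0 => ka _; rewrite mulr_ge0 ?ler0n.
by rewrite mulr_gt0 // ltr0n; apply/card_gt0; [exists p|exists q].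
Qed.

(** * Growth of the coordinates *)

Definition add11 (be : part) : part := ofrow (fun k => row be k + (k < 2))%N.

Lemma row_add11 be k : row (add11 be) k = (row be k + (k < 2))%N.
Proof.
apply: (@row_ofrow _ (size be + 2)%N) => {}k.
  by have := row_noninc be (leqnSn k); lia.
by move=> bk; rewrite (row_eq0 (row_size be)); lia.
Qed.

Lemma psize_add11 be : psize (add11 be) = (psize be + 2)%N.
Proof.
have b0 : row be (size be).+2 = 0%N by apply: row_eq0 (row_size be) _; lia.
have a0 : row (add11 be) (size be).+2 = 0%N by rewrite row_add11 b0.
rewrite (psizeE b0) (psizeE a0).
under eq_bigr do rewrite row_add11.
rewrite big_split /=; congr (_ + _)%N.
by rewrite big_ord_recl big_ord_recl big1.
Qed.

Lemma lrset_add11 la d nu p :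
  lrset la d nu p -> lrset la (d + 2) (add11 nu) (add11 p.1, p.2).
Proof.
move=> [[ev e] gP gd rE]; split=> /=.
- split; last by rewrite psize_add11 e.
  by move=> k; rewrite !row_add11 ev; congr (_ + _)%N; lia.
- by apply: gt_widen gP; rewrite psize_add11 leq_addr.
- by move=> c i; have := gd c i; rewrite /bad !row_add11; lia.
by move=> k; rewrite !row_add11 rE addnAC.
Qed.

Lemma even_psize be : even_part be -> ~~ odd (psize be).
Proof.
move=> ev; have b0 : row be (size be).*2 = 0%N.
  by apply: row_eq0 (row_size be) _; lia.
rewrite (psizeE b0); elim: (size be) => [|n IHn]; first by rewrite big_ord0.
rewrite doubleS !big_ord_recr /= -ev -addnA oddD addnn odd_double addbF.
exact: IHn.
Qed.

Lemma hs_ovr_sub c la mu : hs la mu -> (ovr c la - ovr c mu <= psize la - psize mu)%N.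
Proof.
move=> h; rewrite -!ovr0; elim: c => [|c IHc] //; apply: leq_trans IHc.
have /andP[] := cnt_hs c h; have := hs_ovr c.+1 h.
by rewrite (ovrS c la) (ovrS c mu); lia.
Qed.

(* The first [t] boxes of [la], row after row. *)
Definition boxes (la : part) (t : nat) : part :=
  ofrow (fun k => minn (row la k) (t - \sum_(l < k) row la l))%N.

Lemma row_boxes la t k :
  row (boxes la t) k = minn (row la k) (t - \sum_(l < k) row la l)%N.
Proof.
apply: (@row_ofrow _ (size la)) => {}k.
  by have := row_noninc la (leqnSn k); rewrite big_ord_recr /=; lia.
by move=> lk; rewrite (row_eq0 (row_size la)) // min0n.
Qed.

Lemma psize_boxes la t : psize (boxes la t) = minn (psize la) t.
Proof.
have l0 := row_size la; have b0 : row (boxes la t) (size la) = 0%N.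
  by rewrite row_boxes l0 min0n.
rewrite (psizeE l0) (psizeE b0); elim: (size la) => [|n IHn].
  by rewrite !big_ord0 min0n.
by rewrite !big_ord_recr /= row_boxes; move: IHn => /=; lia.
Qed.

Lemma hs_boxes la t : hs (boxes la t.+1) (boxes la t).
Proof.
move=> k; rewrite !row_boxes big_ord_recr /=.
by have := row_noninc la (leqnSn k); lia.
Qed.

Lemma boxes_full la t : (psize la <= t)%N -> boxes la t = la.
Proof.
move=> lt; apply: part_ext => k; rewrite row_boxes.
have l0 : row la (size la + k.+1)%N = 0%N by apply: row_eq0 (row_size la) _; lia.
have := psizeE l0; rewrite addnS.
have : (\sum_(l < k.+1) row la l <= \sum_(l < (size la + k).+1) row la l)%N.
  rewrite (big_ord_widen (size la + k).+1 (row la)); last by rewrite ltnS leq_addl.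
  by rewrite big_mkcond /=; apply: leq_sum => l _; case: ifP.
by rewrite [X in (X <= _)%N]big_ord_recr /=; lia.
Qed.

Definition stair (m : nat) : part := ofrow (fun k => m.-1 - k./2)%N.

Lemma row_stair m k : row (stair m) k = (m.-1 - k./2)%N.
Proof. by apply: (@row_ofrow _ m.*2) => {}k; lia. Qed.

(* The boxes of [la], read row after row, receive the letters [0], [2], [4],
   and so on, whatever [la]: this leaves [stair m] dominant because its even
   rows are strictly decreasing. *)
Lemma lrset_stair m : exists d nu, ~~ odd d /\
  forall la, psize la = m -> exists p, lrset la d nu p.
Proof.
pose g la i := boxes la (uphalf i).
have wtE la i : psize la = m -> wt (g la) i = (~~ odd i && (i./2 < m))%N :> nat.
  by move=> e; rewrite /wt /g !psize_boxes e; lia.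
have ev : even_part (stair m) by move=> k; rewrite !row_stair; lia.
have gh la i : hs (g la i.+1) (g la i).
  rewrite /g; have [->|->] : uphalf i.+1 = uphalf i \/ uphalf i.+1 = (uphalf i).+1 by lia.
    exact: hs_refl.
  exact: hs_boxes.
pose d := psize (stair m).
pose nu := ofrow (fun k => row (stair m) k + (~~ odd k && (k./2 < m)))%N.
have nuE k : row nu k = (row (stair m) k + (~~ odd k && (k./2 < m)))%N.
  by apply: (@row_ofrow _ m.*2) => {}k; rewrite !row_stair; lia.
exists d, nu; split; first exact: even_psize.
move=> la e; exists (stair m, g la).
have gP : gt m.*2 la (g la).
  split=> [||i mi]; first by apply: part_ext => k; rewrite row_boxes row0; lia.
    exact: gh.
  by apply: boxes_full; lia.
have rE k : row nu k = (row (stair m) k + wt (g la) k)%N by rewrite nuE wtE.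
split=> //=.
- have -> : psize nu = (d + m)%N.
    rewrite (psize_add_wt _ gP rE) ?e // row_stair; lia.
  have [g0 _ _] := gP; split=> // i ni; apply: boxes_full.
  by have := leq_row_psize (stair m) 0; rewrite row_stair -/d; lia.
move=> c i; rewrite /bad -leqNgt !row_stair.
have : (wtcol (g la) c i.+1 <= wt (g la) i.+1)%N by apply: hs_ovr_sub.
by rewrite (wtE la) //; case: (boolP (odd i)) => oi /=; lia.
Qed.

Theorem theorem4p12 (m : nat) (la mu : part)
    (hla : psize la = m) (hmu : psize mu = m) :
  exists! n0 : nat,
    [/\ Nset m n0,
        forall n : nat, Nset m n -> (n < n0)%N ->
          hall n (ss la n) (ss mu n) = 0 &
        forall n : nat, Nset m n -> (n0 <= n)%N ->
          0 < hall n (ss la n) (ss mu n)].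
Proof.
pose h n := hall n (ss la n) (ss mu n); rewrite -/(h _).
have e : psize la = psize mu by rewrite hla hmu.
have ge0 n : Nset m n -> 0 <= h n.
  by move=> [mn _]; have := hall_ge0 (n - m) e; rewrite hla subnKC.
have step n : Nset m n -> 0 < h n -> 0 < h n.+2.
  move=> [mn _]; have := hall_gt0 (n - m) e.
  have := hall_gt0 (n - m + 2) e; rewrite hla addnA subnKC // addn2 => -[_ up] [dn _].
  move=> /dn[nu [p [q [lp lq]]]]; apply: up.
  by do 3 eexists; split; apply: lrset_add11; [exact: lp | exact: lq].
have [d [nu [dev st]]] := lrset_stair m.
have [[p lp] [q lq]] := (st la hla, st mu hmu).
pose P n := `[< Nset m n >] && (0 < h n).
have exP : exists n, P n.
  exists (m + d)%N; apply/andP; split.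
    by apply/asboolP; split; [exact: leq_addr | lia].
  by have [_] := hall_gt0 d e; rewrite hla; apply; exists nu, p, q.
case: (ex_minnP exP) => n0 /andP[/asboolP N0 h0] n0min.
have pos n : Nset m n -> (n0 <= n)%N -> 0 < h n.
  move=> [mn pn] n0n; have [k ->] : exists k, n = (n0 + k.*2)%N.
    by exists (n - n0)./2; case: N0 => ? ?; lia.
  elim: k => [|k IHk]; first by rewrite addn0.
  rewrite doubleS !addnS; apply: step => //.
  by case: N0 => m0 p0; split; [lia | rewrite -p0; lia].
exists n0; split.
  split=> // n Nn lt; apply/eqP; rewrite eq_le ge0 // andbT leNgt.
  by apply: contraL lt => hn; rewrite -leqNgt n0min // /P hn andbT; apply/asboolP.
move=> n1 [N1 z1 p1]; case: (ltngtP n0 n1) => // lt.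
  by move: h0; rewrite /h z1 // ltxx.
by have := n0min n1; rewrite /P p1 // andbT leqNgt lt => /(_ (asboolT N1)).
Qed.
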